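(* Let $(G,G^+,u)$ be a simple dimension group with unit, and let $(p_n)_{n\in\mathbb{N}}$ be a sequence of positive real numbers such that $\lim_{n\to\infty} n/p_n=0$. Assume that $G$ is a divisible group. Then there exists a minimal Toeplitz subshift $(Y,S)$ such that (1) $K^0(Y,S)$ and $(G,G^+,u)$ are isomorphic as ordered groups with unit; and (2) the complexity function $p_Y$ of $(Y,S)$ satisfies $\lim_{n\to\infty} p_Y(n)/p_n=0$.
   Context: $\mathbb{N}$ denotes the non-negative integers. An abelian group $G$ is divisible if for each $g\in G$ and each integer $k\ge1$ there is $h\in G$ with $kh=g$. Subshifts. An alphabet is a finite non-empty set $\mathcal{A}$; $\mathcal{A}^{\mathbb{Z}}$ carries the product topology of the discrete topologies, and $S((x_i)_{i\in\mathbb{Z}})=(x_{i+1})_{i\in\mathbb{Z}}$ is the shift. A subshift $(Y,S)$ is a closed shift-invariant subset $Y\subseteq\mathcal{A}^{\mathbb{Z}}$ together with the restriction of $S$. It is minimal if every $S$-orbit is dense in $Y$. The complexity function $p_Y(n)$ is the number of distinct words of length $n$ occurring as blocks of consecutive letters in elements of $Y$. A Toeplitz sequence is $x\in\mathcal{A}^{\mathbb{Z}}$ such that for all $i\in\mathbb{Z}$ there is an integer $p\ge1$ with $x_i=x_{i+kp}$ for all $k\in\mathbb{Z}$. A Toeplitz subshift is the orbit closure, under the shift, of a Toeplitz sequence. Ordered groups. An ordered group is a pair $(G,G^+)$ where $G$ is a countable abelian group and $G^+\subseteq G$ (the positive cone) satisfies $G^++G^+\subset G^+$, $G^+\cap(-G^+)=\{0\}$,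 $G^+-G^+=G$. Write $a\le b$ if $b-a\in G^+$. An order unit is $u\in G^+$ such that for each $a\in G$ there is a non-negative integer $k$ with $a\le ku$. Two ordered groups with unit $(G,G^+,u)$, $(H,H^+,v)$ are isomorphic if there is a group isomorphism $\varphi:G\to H$ with $\varphi(G^+)=H^+$ and $\varphi(u)=v$. Inductive limits. For homomorphisms $h_i:G_i\to G_{i+1}$, $i\in\mathbb{N}$, $\varinjlim_i(G_i,h_i)$ is the set of classes $[g,i]$ of pairs $(g,i)$, $g\in G_i$, where $(g,i)\sim(g',i')$ iff $h_k\circ\cdots\circ h_i(g)=h_k\circ\cdots\circ h_{i'}(g')$ for some $k\ge i,i'$, with its natural group structure. For $G_i=\mathbb{Z}^{d_i}$ and $h_i$ given by a matrix $A_i$ with non-negative integer entries, the induced order has positive cone consisting of the classes $[x,i]$ that have some representative $(x',i')$ with $x'$ having all coordinates non-negative. Dimension groups. An ordered group $(G,G^+)$ is a dimension group if it is isomorphic (as an ordered group) to an inductive limit $\mathbb{Z}^{d_0}\xrightarrow{A_0}\mathbb{Z}^{d_1}\xrightarrow{A_1}\mathbb{Z}^{d_2}\xrightarrow{A_2}\cdots$ with integers $d_i\ge 1$ and positive homomorphisms $A_i$ (given by non-negative integer matrices), endowed with the induced order. It is simple if all matrices $A_i$ can be chosen with strictly positive entries. A simple dimension group with unit is a triple $(G,G^+,u)$ with $(G,G^+)$ a simple dimension group and $u$ an order unit. Dynamical dimension group. For a dynamical system $(X,T)$ ($X$ compact metric, $T$ a homeomorphism), let $\beta f=f\circ T-f$.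 Then $K^0(X,T)=(H(X,T),H^+(X,T),[1])$ where $H(X,T)=C(X,\mathbb{Z})/\beta C(X,\mathbb{Z})$, $H^+(X,T)$ is the set of classes of non-negative functions, and $[1]$ is the class of the constant function $1$. *)

(* Defs.v *)
From HB Require Import structures.
From mathcomp Require Import all_boot all_order all_algebra.
From mathcomp Require Import all_classical all_reals all_analysis.
From mathcomp Require Import zify.

Set Implicit Arguments.
Unset Strict Implicit.
Unset Printing Implicit Defensive.
Import Order.TTheory GRing.Theory Num.Theory.
Local Open Scope classical_set_scope.
Local Open Scope ring_scope.
Local Open Scope quotient_scope.

Definition divisible (G : zmodType) : Prop :=
  forall (g : G) (k : nat), (1 <= k)%N -> exists h : G, h *+ k = g.

Record is_ordered_group (G : zmodType) (P : set G) : Prop := IsOrderedGroup {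
  og_countable : countable [set: G];
  og_add : forall a b, P a -> P b -> P (a + b);
  og_proper : P `&` [set a | P (- a)] = [set 0];
  og_generating : forall g, exists a b, [/\ P a, P b & g = a - b]
}.

Definition is_order_unit (G : zmodType) (P : set G) (u : G) : Prop :=
  P u /\ forall a, exists k : nat, P (u *+ k - a).

Definition ordered_group_iso (G H : zmodType) (P : set G) (Q : set H) : Prop :=
  exists phi : {additive G -> H}, bijective phi /\ phi @` P = Q.

Definition unital_ordered_group_iso (G H : zmodType)
    (P : set G) (u : G) (Q : set H) (v : H) : Prop :=
  exists phi : {additive G -> H},
    [/\ bijective phi, phi @` P = Q & phi u = v].

Section InductiveLimit.
Variables (G : nat -> zmodType) (h : forall i, {additive G i -> G i.+1}).

(* The pair (g, i) is encoded as [Tagged G g : {i & G i}]. *)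
Local Notation pairs := {i : nat & G i}.

Definition ilim_step (a : pairs) : pairs := Tagged G (h (tag a) (tagged a)).

(* [iter m.+1 ilim_step (Tagged G g)], for g in G_i, is h_k (... (h_i g)) with
   k = m + i, as an element of G_{k+1}; equality in the sigma-type forces the
   two sides to live in the same G_{k+1}. *)
Definition ilim_rel (a b : pairs) : bool :=
  `[< exists m n, iter m.+1 ilim_step a = iter n.+1 ilim_step b >].

Lemma ilim_tag n a : tag (iter n ilim_step a) = (n + tag a)%N.
Proof. by elim: n => //= n ->. Qed.

Lemma ilim_relP a b :
  reflect (exists m n, iter m ilim_step a = iter n ilim_step b) (ilim_rel a b).
Proof.
apply: (iffP (asboolP _)) => -[m [n e]]; first by exists m.+1, n.+1.
by exists m, n; rewrite !iterS e.
Qed.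

Lemma ilim_rel_equiv : equiv_class_of ilim_rel.
Proof.
have sym a b : ilim_rel a b -> ilim_rel b a.
  by move=> /ilim_relP[m [n e]]; apply/ilim_relP; exists n, m.
split=> [a|a b|b a c]; first by apply/ilim_relP; exists 0%N, 0%N.
  by apply/idP/idP => /sym.
move=> /ilim_relP[m [n e]] /ilim_relP[m' [n' e']]; apply/ilim_relP.
exists (m' + m)%N, (n + n')%N.
by rewrite iterD e -iterD addnC iterD e' -iterD.
Qed.

Canonical ilim_equivRel := EquivRelPack ilim_rel_equiv.
Canonical ilim_encModRel := defaultEncModRel ilim_rel.

Definition ilim := {eq_quot ilim_rel}.
HB.instance Definition _ : EqQuotient _ ilim_rel ilim := EqQuotient.on ilim.
HB.instance Definition _ := Choice.on ilim.

Definition ilim_class (i : nat) (g : G i) : ilim := \pi_ilim (Tagged G g).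

(* Meaningful only when [tag a = tag b]; [tagged_as] is then the cast of b into
   the fibre of a.  [ilim_addp] first pushes g in G_i and g' in G_j to G_{i+j};
   [ilim_addE] checks the resulting law on classes. *)
Definition ilim_add_at (a b : pairs) : pairs :=
  Tagged G (tagged a + tagged_as a b).
Definition ilim_addp (a b : pairs) : pairs :=
  ilim_add_at (iter (tag b) ilim_step a) (iter (tag a) ilim_step b).
Definition ilim_oppp (a : pairs) : pairs := Tagged G (- tagged a).

Lemma ilim_classP a b : (\pi_ilim a == \pi_ilim b) = ilim_rel a b.
Proof. by rewrite piE. Qed.

Lemma ilim_class_eqP a b : reflect
  (exists m n, iter m ilim_step a = iter n ilim_step b)
  (\pi_ilim a == \pi_ilim b).
Proof. by rewrite ilim_classP; exact: ilim_relP. Qed.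

Lemma ilim_class_iter n a : \pi_ilim (iter n ilim_step a) = \pi_ilim a.
Proof. by apply/eqP/ilim_class_eqP; exists 0%N, n. Qed.

Lemma ilim_add_atE i (x y : G i) :
  ilim_add_at (Tagged G x) (Tagged G y) = Tagged G (x + y).
Proof.
rewrite /ilim_add_at /=; congr (Tagged G (_ + _)).
exact: (@tagged_asE nat (fun i => G i) (Tagged G x) y).
Qed.

Lemma ilim_add_at_step a b : tag a = tag b ->
  ilim_step (ilim_add_at a b) = ilim_add_at (ilim_step a) (ilim_step b).
Proof.
case: a b => [i x] [j y] /= eij; case: j / eij y => y.
rewrite -/(Tagged G x) -/(Tagged G y) ilim_add_atE /ilim_step /=.
by rewrite ilim_add_atE raddfD.
Qed.

Lemma ilim_add_at_iter n a b : tag a = tag b ->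
  iter n ilim_step (ilim_add_at a b) =
  ilim_add_at (iter n ilim_step a) (iter n ilim_step b).
Proof.
move=> eab; elim: n => //= n ->; rewrite ilim_add_at_step //.
by rewrite !ilim_tag eab.
Qed.

Lemma ilim_addp_iter m n a b : (m + tag a = n + tag b)%N ->
  \pi_ilim (ilim_addp a b) =
  \pi_ilim (ilim_add_at (iter m ilim_step a) (iter n ilim_step b)).
Proof.
move=> e; rewrite /ilim_addp.
rewrite -(ilim_class_iter m) ilim_add_at_iter ?ilim_tag 1?addnC //.
rewrite -[RHS](ilim_class_iter (tag b)) ilim_add_at_iter ?ilim_tag //.
rewrite -!iterD [(tag b + m)%N]addnC.
by rewrite e [(n + _)%N]addnC.
Qed.

Lemma ilim_class_surj (q : ilim) : exists i (x : G i), q = ilim_class x.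
Proof.
by case: (repr q) (reprK q) => i x <-; exists i, x.
Qed.

Lemma ilim_common a b : exists i (x y : G i) m n,
  iter m ilim_step a = Tagged G x /\ iter n ilim_step b = Tagged G y.
Proof.
have := ilim_tag (tag b) a; have := ilim_tag (tag a) b.
case e1: (iter _ _ b) => [j y]; case e2: (iter _ _ a) => [i x] /=.
rewrite addnC => ej ei; subst i; subst j.
by exists (tag b + tag a)%N, x, y, (tag b), (tag a).
Qed.

Definition ilim_zero : ilim := lift_cst ilim (Tagged G (0 : G 0%N)).
Definition ilim_opp := lift_op1 ilim ilim_oppp.
Definition ilim_add := lift_op2 ilim ilim_addp.

Lemma ilim_oppp_iter n a :
  iter n ilim_step (ilim_oppp a) = ilim_oppp (iter n ilim_step a).
Proof. by elim: n => //= n ->; rewrite /ilim_step /ilim_oppp /= raddfN. Qed.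

Lemma ilim_pi_opp : {morph \pi_ilim : a / ilim_oppp a >-> ilim_opp a}.
Proof.
move=> a; unlock ilim_opp.
have /eqP/ilim_class_eqP[m [n e]] := esym (reprK (\pi_ilim a)).
apply/eqP/ilim_class_eqP; exists m, n.
by rewrite !ilim_oppp_iter e.
Qed.
Canonical ilim_pi_opp_morph := PiMorph1 ilim_pi_opp.

Lemma ilim_pi_add : {morph \pi_ilim : a b / ilim_addp a b >-> ilim_add a b}.
Proof.
move=> a b; unlock ilim_add.
have /eqP/ilim_class_eqP[m [n e]] := esym (reprK (\pi_ilim a)).
have /eqP/ilim_class_eqP[m' [n' e']] := esym (reprK (\pi_ilim b)).
set a' := repr _ in e *; set b' := repr _ in e' *.
have et := congr1 (@tag _ _) e; have et' := congr1 (@tag _ _) e'.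
rewrite !ilim_tag in et et'.
rewrite (@ilim_addp_iter (m' + tag b + m) (m + tag a + m')); last by lia.
rewrite (@ilim_addp_iter (m' + tag b + n) (m + tag a + n') a' b'); last by lia.
by rewrite !iterD e e'.
Qed.
Canonical ilim_pi_add_morph := PiMorph2 ilim_pi_add.

Lemma ilim_addE i (x y : G i) :
  ilim_add (ilim_class x) (ilim_class y) = ilim_class (x + y).
Proof.
rewrite /ilim_class -ilim_pi_add (@ilim_addp_iter 0 0) //=.
by rewrite ilim_add_atE.
Qed.

Lemma ilim_oppE i (x : G i) : ilim_opp (ilim_class x) = ilim_class (- x).
Proof. by rewrite /ilim_class -ilim_pi_opp. Qed.

Lemma ilim_zeroE i : ilim_zero = ilim_class (0 : G i).
Proof.
unlock ilim_zero; apply/eqP/ilim_class_eqP; exists i, 0%N => /=.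
suff E n : iter n ilim_step (Tagged G (0 : G 0%N)) = Tagged G (0 : G n).
  by rewrite E.
by elim: n => //= n ->; rewrite /ilim_step /= raddf0.
Qed.

Lemma ilim_class_step i (x : G i) : ilim_class (h i x) = ilim_class x.
Proof. exact: (ilim_class_iter 1 (Tagged G x)). Qed.

Lemma ilim_common_class (p q : ilim) :
  exists i (x y : G i), p = ilim_class x /\ q = ilim_class y.
Proof.
have [i [x ->]] := ilim_class_surj p; have [j [y ->]] := ilim_class_surj q.
have [k [x' [y' [m [n [ex ey]]]]]] := ilim_common (Tagged G x) (Tagged G y).
exists k, x', y'; rewrite /ilim_class -ex -ey.
by rewrite !ilim_class_iter.
Qed.

Lemma ilim_class_iter_class m i (x : G i) :
  exists x' : G (m + i)%N, ilim_class x = ilim_class x'.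
Proof.
elim: m => [|m [x' ->]]; first by exists x.
by exists (h _ x'); rewrite -ilim_class_step.
Qed.

Lemma ilim_common3 (p q r : ilim) : exists i (x y z : G i),
  [/\ p = ilim_class x, q = ilim_class y & r = ilim_class z].
Proof.
have [i [x [y [-> ->]]]] := ilim_common_class p q.
have [j [z ->]] := ilim_class_surj r.
have [x' ->] := ilim_class_iter_class j x.
have [y' ->] := ilim_class_iter_class j y.
have [z' ->] := ilim_class_iter_class i z.
move: z'; rewrite addnC => z'.
by exists (j + i)%N, x', y', z'.
Qed.

Lemma ilim_addA : associative ilim_add.
Proof.
move=> p q r; have [i [x [y [z [-> -> ->]]]]] := ilim_common3 p q r.
by rewrite !ilim_addE addrA.
Qed.

Lemma ilim_addC : commutative ilim_add.
Proof.
move=> p q; have [i [x [y [-> ->]]]] := ilim_common_class p q.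
by rewrite !ilim_addE addrC.
Qed.

Lemma ilim_add0 : left_id ilim_zero ilim_add.
Proof.
move=> p; have [i [x ->]] := ilim_class_surj p.
by rewrite (ilim_zeroE i) ilim_addE add0r.
Qed.

Lemma ilim_addN : left_inverse ilim_zero ilim_opp ilim_add.
Proof.
move=> p; have [i [x ->]] := ilim_class_surj p.
by rewrite ilim_oppE ilim_addE addNr -ilim_zeroE.
Qed.

HB.instance Definition _ :=
  GRing.isZmodule.Build ilim ilim_addA ilim_addC ilim_add0 ilim_addN.

End InductiveLimit.

Section DimensionGroup.
Variables (d : nat -> nat) (A : forall i, 'M[int]_(d i.+1, d i)).

(* Group elements are column vectors, so that A_i acts on the left and has
   d_{i+1} rows and d_i columns. *)
Definition mx_hom (i : nat) : {additive 'cV[int]_(d i) -> 'cV[int]_(d i.+1)} :=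
  @mulmx int (d i.+1) (d i) 1 (A i).

Definition mx_ilim : zmodType := ilim mx_hom.

Definition mx_ilim_cone : set mx_ilim :=
  [set q | exists i (x : 'cV[int]_(d i)),
     q = ilim_class mx_hom x /\ forall j, 0 <= x j 0].

End DimensionGroup.
Arguments mx_ilim_cone [d] A _.

Definition is_dimension_group (G : zmodType) (P : set G) : Prop :=
  is_ordered_group P /\
  exists (d : nat -> nat) (A : forall i, 'M[int]_(d i.+1, d i)),
    [/\ forall i, (1 <= d i)%N,
        forall i j k, 0 <= A i j k
      & ordered_group_iso P (mx_ilim_cone A)].

Definition is_simple_dimension_group (G : zmodType) (P : set G) : Prop :=
  is_dimension_group P /\
  exists (d : nat -> nat) (A : forall i, 'M[int]_(d i.+1, d i)),
    [/\ forall i, (1 <= d i)%N,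
        forall i j k, 0 < A i j k
      & ordered_group_iso P (mx_ilim_cone A)].

Definition is_simple_dimension_group_with_unit
    (G : zmodType) (P : set G) (u : G) : Prop :=
  is_simple_dimension_group P /\ is_order_unit P u.

Definition CZ (X : topologicalType) : Type :=
  continuousType X (discrete_topology int).
HB.instance Definition _ (X : topologicalType) := Choice.on (CZ X).

Section ContinuousIntegerFunctions.
Variable X : topologicalType.
Implicit Types f g : CZ X.

(* [discrete_topology int] carries no ring structure, hence this cast. *)
Definition CZ_val (f : CZ X) : X -> int := f.

Lemma CZ_locally_cst f x : \forall y \near x, CZ_val f y = CZ_val f x.
Proof.
have := @cts_fun _ _ f x => /(_ [set CZ_val f x]) H.
by apply: H; apply: discrete_set1.
Qed.

Lemma locally_cst_cts (f : X -> int) :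
  (forall x, \forall y \near x, f y = f x) ->
  continuous (f : X -> discrete_topology int).
Proof.
move=> fl x B /= /nbhs_singleton Bx; rewrite /nbhs /=.
by apply: filterS (fl x) => y /= ->.
Qed.

Lemma CZ_zero_cts : continuous ((fun=> 0 : int) : X -> discrete_topology int).
Proof. by apply: locally_cst_cts => x; apply: nearW. Qed.

Lemma CZ_opp_cts f :
  continuous ((fun x => - CZ_val f x) : X -> discrete_topology int).
Proof.
by apply: locally_cst_cts => x; apply: filterS (CZ_locally_cst f x) => y ->.
Qed.

Lemma CZ_add_cts f g :
  continuous ((fun x => CZ_val f x + CZ_val g x) : X -> discrete_topology int).
Proof.
apply: locally_cst_cts => x.
by apply: filterS2 (CZ_locally_cst f x) (CZ_locally_cst g x) => y -> ->.
Qed.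

Lemma CZ_one_cts : continuous ((fun=> 1 : int) : X -> discrete_topology int).
Proof. by apply: locally_cst_cts => x; apply: nearW. Qed.

Definition CZ_zero : CZ X := mkcts CZ_zero_cts.
Definition CZ_one : CZ X := mkcts CZ_one_cts.
Definition CZ_opp f : CZ X := mkcts (@CZ_opp_cts f).
Definition CZ_add f g : CZ X := mkcts (@CZ_add_cts f g).

Lemma CZ_eq f g : CZ_val f =1 CZ_val g -> f = g.
Proof. by move=> fg; apply/continuousEP => x; exact: fg. Qed.

Lemma CZ_addA : associative CZ_add.
Proof. by move=> f g k; apply: CZ_eq => x; exact: addrA. Qed.

Lemma CZ_addC : commutative CZ_add.
Proof. by move=> f g; apply: CZ_eq => x; exact: addrC. Qed.

Lemma CZ_add0 : left_id CZ_zero CZ_add.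
Proof. by move=> f; apply: CZ_eq => x; exact: add0r. Qed.

Lemma CZ_addN : left_inverse CZ_zero CZ_opp CZ_add.
Proof. by move=> f; apply: CZ_eq => x; exact: addNr. Qed.

HB.instance Definition _ :=
  GRing.isZmodule.Build (CZ X) CZ_addA CZ_addC CZ_add0 CZ_addN.

End ContinuousIntegerFunctions.

Section DynamicalSystem.
Variables (X : topologicalType) (T : X -> X).

(* For invertible T this is {T^n x : n in Z}. *)
Definition orbit (x : X) : set X :=
  [set y | exists n : nat, y = iter n T x \/ x = iter n T y].

Definition minimal_system : Prop := forall x, dense (orbit x).

Definition coboundary : {pred CZ X} :=
  fun k => `[< exists f : CZ X,
                 forall x, CZ_val k x = CZ_val f (T x) - CZ_val f x >].

Lemma coboundary_zmod_closed : zmod_closed coboundary.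
Proof.
split; first by apply/asboolP; exists 0 => x; rewrite subrr.
move=> k l /asboolP[f fk] /asboolP[g gl]; apply/asboolP; exists (f - g) => x.
have E (a b : CZ X) y : CZ_val (a - b) y = CZ_val a y - CZ_val b y by [].
by rewrite !E fk gl !opprD !opprK addrACA.
Qed.

HB.instance Definition _ :=
  GRing.isZmodClosed.Build (CZ X) coboundary coboundary_zmod_closed.

Definition K0 : zmodType := Quotient.quot coboundary.

Definition K0_cone : set K0 :=
  [set q | exists f : CZ X, q = \pi_K0 f /\ forall x, 0 <= CZ_val f x].

Definition K0_unit : K0 := \pi_K0 (CZ_one X).

End DynamicalSystem.
Arguments K0_cone [X] T _.

Definition full_shift (A : finType) : topologicalType :=
  {ptws int -> discrete_topology A}.

Section Subshifts.
Variable A : finType.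

Definition shift (x : full_shift A) : full_shift A := fun i => x (i + 1).

Record subshift := Subshift {
  subshift_set :> set (full_shift A);
  subshift_closed : closed subshift_set;
  subshift_invariant : shift @` subshift_set = subshift_set
}.

Definition subshift_space (Y : subshift) : topologicalType :=
  set_type (subshift_set Y).

Lemma subshift_mem (Y : subshift) (y : subshift_space Y) :
  shift (set_val y) \in subshift_set Y.
Proof.
have : (shift @` Y) (shift (set_val y)).
  by exists (set_val y); first exact: set_valP.
by rewrite subshift_invariant => /mem_set.
Qed.

Definition subshift_map (Y : subshift) (y : subshift_space Y) :
  subshift_space Y := exist _ (shift (set_val y)) (subshift_mem y).

Definition toeplitz_sequence (x : full_shift A) : Prop :=
  forall i : int, exists p : nat,
    (1 <= p)%N /\ forall k : int, x i = x (i + k * p%:Z).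

Definition is_toeplitz_subshift (Y : subshift) : Prop :=
  exists x, toeplitz_sequence x /\ subshift_set Y = closure (orbit shift x).

Definition block (x : full_shift A) (i : int) (n : nat) : n.-tuple A :=
  [tuple (x (i + (j : nat)%:Z) : A) | j < n].

Definition complexity (Y : subshift) (n : nat) : nat :=
  #|[pred w : n.-tuple A |
      `[< exists x, subshift_set Y x /\ exists i, w = block x i n >]]|.

End Subshifts.

(* Main.v *)
Require Import Defs.
From mathcomp Require Import all_boot all_order all_algebra.
From mathcomp Require Import all_classical all_reals all_analysis.
From mathcomp Require Import zify ring.
From HB Require Import structures.
Import Order.TTheory GRing.Theory Num.Theory.
Import numFieldNormedType.Exports.
Local Open Scope classical_set_scope.
Local Open Scope ring_scope.
Set Implicit Arguments.
Unset Strict Implicit.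
Unset Printing Implicit Defensive.

(** The subshift is built from substitutions of constant length.  A simple
    dimension group is the limit of positive integer matrices; choosing words
    whose letter counts are the rows of these matrices gives substitutions
    sigma_n from level n+1 letters to words in level n letters, and the limit
    sequence of sigma_0 o ... o sigma_n generates a subshift whose
    Kakutani-Rokhlin towers reproduce the given matrices.  Constant length is
    possible because the unit u provides positive weights v_n, with v_(n+1) =
    A_n v_n: the conjugates A_n(a,c) v_n(c) / v_(n+1)(a) have rational entries
    and row sums 1, and G, being divisible and hence a rational vector space, is
    also the limit of the integer matrices obtained by multiplying them by any
    positive multiples of the products over a of v_(n+1)(a).  In terms of G itself, the class of the base of the
    level n tower over c is v_n(c) E_n(c) / (3 h_n), where E_n(c) is the image of
    a basis vector and h_n the height ([height_weight_model]).

    This freedom in the integer multipliers is also what controls complexity.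
    Each sigma_n(a) is a fixed word in which every letter is repeated K_n times,
    K_n being free.  A factor whose length k is between h_n and K_n h_n sees at
    most one change of level n letter, so that there are at most 2 l_n^2 k of
    them; and h_(n+1) is a bounded multiple of K_n h_n.  Hence p_Y(k) <= C_n k
    for h_n <= k <= h_(n+1), with C_n independent of K
    ([complexity_linear]).  As k / p_k tends to 0, the K_n can be taken so large that
    C_n k / p_k <= 1 / (n+1) for n >= 1 and k >= h_n ([ratio_cvg0]).

    Each fixed word is a concatenation of runs
    0^(a+1) 1^(m 1) 0^(m 0 - a - 1) 2^(m 2) ... (l-1)^(m (l-1)).
    All words at a level share their first and their last letter, which makes the
    limit sequence Toeplitz and the subshift minimal.  The two-letter word
    (l-1) 0 occurs only where two words meet, and the length of the first run
    determines a; so the level n+1 structure of a point can be read off its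
    level n structure ([base_seq_block]), which yields unique clopen tower
    decompositions of every point of the subshift.  The letter a has to be
    encoded in the order of the letters rather than in their counts, since
    different letters may have equal rows.  This shape requires at least three
    letters: each vertex of the given diagram is used three times, which explains
    the factors 3.

    Finally K^0 is computed by sending a continuous function f, constant on the
    levels of the towers of some stage n, to the sum over a of (sum of f over the
    tower of a) times the class of that tower.  Coboundaries go to 0 because all
    points at a cut agree on a long window; conversely, when the value is 0 the
    tower sums vanish at a later stage, and summing f up each tower
    solves f = F o T - F ([K0_iso]). *)

(** * The full shift: windows and compactness *)

Section FullShiftTopology.
Variable A : finType.
Implicit Types x y z : full_shift A.

Definition agree (W : nat) y z := forall i : int, `|i| <= W%:Z -> z i = y i.

Lemma nbhs_agree y W : nbhs y [set z | agree W y z].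
Proof.
have P i : nbhs y [set z : full_shift A | z i = y i].
  have /(_ [set y i]) := @proj_continuous int (fun=> discrete_topology A) i y.
  by apply; exact: discrete_set1.
have Q n : nbhs y [set z : full_shift A | forall k, (k < n)%N ->
    z (k%:Z - W%:Z) = y (k%:Z - W%:Z)].
  elim: n => [|n IH]; first by apply: filterS filterT => z _ k.
  apply: filterS2 IH (P (n%:Z - W%:Z)) => z Hz Hn k.
  by rewrite ltnS leq_eqVlt => /orP[/eqP->//|/Hz].
apply: filterS (Q W.*2.+1) => z H i iW.
have -> : i = (absz (i + W%:Z))%:Z - W%:Z by lia.
by apply: H; lia.
Qed.

Lemma nbhs_window y (B : set (full_shift A)) :
  nbhs y B -> exists W, forall z, agree W y z -> B z.
Proof.
pose F : set_system (full_shift A) :=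
  [set B | exists W, forall z, agree W y z -> B z].
have FF : Filter F.
  split; first by exists 0%N.
  - move=> P Q [W1 H1] [W2 H2]; exists (maxn W1 W2) => z Hz.
    by split; [apply: H1|apply: H2] => i Hi; apply: Hz; lia.
  - by move=> P Q PQ [W H]; exists W => z /H /PQ.
suff /(_ B) : F --> y by apply.
apply/(@pointwise_cvgP (discrete_topology int) (discrete_topology A)) => t Q /= Qt.
exists `|t|%N => z /(_ t); rewrite abszE lexx => /(_ isT) /= ->.
exact: nbhs_singleton Qt.
Qed.

Lemma full_shift_compact : compact [set: full_shift A].
Proof.
have fA : finite_set [set: A] by exact: finite_finset.
have := @tychonoff int (fun=> discrete_topology A) (fun=> setT)
  (fun=> @finite_compact (discrete_topology A) setT fA).
by congr compact; apply/seteqP; split.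
Qed.

Lemma closureP (B : set (full_shift A)) y :
  closure B y <-> forall W, exists2 z, B z & agree W y z.
Proof.
split=> [H W|H C /nbhs_window[W HW]].
  by have [z [Bz Hz]] := H _ (nbhs_agree y W); exists z.
by have [z Bz /HW] := H W; exists z.
Qed.

End FullShiftTopology.

Section SubshiftTopology.
Variables (A : finType) (Y : subshift A).
Implicit Types y z : subshift_space Y.

Lemma subshift_nbhsP y (B : set (subshift_space Y)) :
  nbhs y B <-> exists W, forall z, agree W (set_val y) (set_val z) -> B z.
Proof.
split=> [[C [[D oD DC] Cy CB]]|[W HW]].
  have /nbhs_window[W HW] : nbhs (set_val y) D.
    by apply: open_nbhs_nbhs; split => //; rewrite -DC in Cy.
  by exists W => z /HW Dz; apply: CB; rewrite -DC.
have H : nbhs y [set z : subshift_space Y | agree W (set_val y) (set_val z)].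
  exact: (@initial_continuous _ _ (set_val : Y -> full_shift A) y _
    (nbhs_agree (set_val y) W)).
by apply: (filterS _ H) => z /HW.
Qed.

(** Compactness: pairs of points that agree on larger and larger windows but are
    separated by f have a cluster point, near which f is constant. *)
Lemma CZ_window (f : CZ (subshift_space Y)) : exists W, forall y z,
  agree W (set_val y) (set_val z) -> CZ_val f z = CZ_val f y.
Proof.
apply: contrapT => noW.
have bad W : exists yz : subshift_space Y * subshift_space Y,
    agree W (set_val yz.1) (set_val yz.2) /\ CZ_val f yz.2 <> CZ_val f yz.1.
  apply: contrapT => nW; apply: noW; exists W => y z yz.
  by apply: contrapT => fyz; apply: nW; exists (y, z).
have {noW} [g Hg] := choice bad.
have cY : compact (subshift_set Y).
  exact: subclosed_compact (subshift_closed (s := Y)) (@full_shift_compact A) _.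
have PF : ProperFilter ((fun W => set_val (g W).1) @ \oo) by apply: fmap_proper_filter.
have /(_ _)[|y [Yy cl]] := cY _ PF.
  by exists 0%N => // W _ /=; apply: set_valP.
pose y' : subshift_space Y := exist _ y (mem_set Yy).
have [V HV] := (subshift_nbhsP y' _).1 (CZ_locally_cst f y').
have FV : ((fun W => set_val (g W).1) @ \oo)
    [set set_val (g W).1 | W in [set W | (V <= W)%N]].
  by exists V => // W VW; exists W.
have [z [[W VW Wz] az]] := cl _ _ FV (nbhs_agree y V).
rewrite -{z}Wz in az.
have [ag] := Hg W; apply.
rewrite (HV (g W).1) // (HV (g W).2) // => i iV.
by rewrite ag; [exact: az | apply: le_trans iV _; rewrite lez_nat].
Qed.

Lemma window_continuous (f : subshift_space Y -> int) W :
  (forall y z, agree W (set_val y) (set_val z) -> f z = f y) ->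
  continuous (f : _ -> discrete_topology int).
Proof.
move=> Hf; apply: locally_cst_cts => y; apply/subshift_nbhsP.
by exists W => z; apply: Hf.
Qed.

End SubshiftTopology.

(** * The limit sequence of a sequence of substitutions *)
Lemma divmod_int (q : nat) (k : int) : (0 < q)%N ->
  exists t r, [/\ k = t * q%:Z + r%:Z & (r < q)%N].
Proof.
move=> q0; exists (k %/ q%:Z)%Z, (absz (k %% q%:Z)%Z).
have q0' : q%:Z != 0 by lia.
have := divz_eq k q; have := modz_ge0 k q0'; have := @ltz_mod k q q0'.
by move: q0; split; lia.
Qed.

Lemma divmod_intE (q : nat) (t : int) (r : nat) : (r < q)%N ->
  ((t * q%:Z + r%:Z) %/ q%:Z)%Z = t /\ ((t * q%:Z + r%:Z) %% q%:Z)%Z = r%:Z.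
Proof.
move=> rq; have q0 : q%:Z != 0 by lia.
split; first by rewrite divzMDl // divz_small ?addr0 //; lia.
by rewrite modzMDl modz_small //; lia.
Qed.

(** Level n has the letters 0, ..., l n - 1, and [om n a] is the word attached to
    the letter a of level n+1.  The marker condition says that the last letter
    followed by the first one is never seen inside a word, so that this pair
    signals the boundaries between words. *)
Record coding (l b : nat -> nat) (om : nat -> nat -> seq nat) : Prop := Coding {
  cod_l : forall n, (1 < l n)%N;
  cod_b : forall n, (1 < b n)%N;
  cod_size : forall n a, (a < l n.+1)%N -> size (om n a) = b n;
  cod_letter : forall n a c, (a < l n.+1)%N -> c \in om n a = (c < l n)%N;
  cod_first : forall n a, (a < l n.+1)%N -> nth 0%N (om n a) 0 = 0%N;
  cod_last : forall n a, (a < l n.+1)%N -> nth 0%N (om n a) (b n).-1 = (l n).-1;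
  cod_marker : forall n a j, (a < l n.+1)%N -> (j.+1 < b n)%N ->
    nth 0%N (om n a) j = (l n).-1 -> nth 0%N (om n a) j.+1 <> 0%N;
  cod_inj : forall n a a', (a < l n.+1)%N -> (a' < l n.+1)%N ->
    om n a = om n a' -> a = a'
}.

Section ToeplitzSequence.
Variables (l b K : nat -> nat) (om : nat -> nat -> seq nat).
Hypothesis cod : coding l b om.
Hypothesis K_gt0 : forall n, (0 < K n)%N.

(** The repetition factor K n changes neither the markers nor the injectivity of
    the words; it is the free parameter that keeps the complexity low. *)
Definition sigma n a j := nth 0%N (om n a) (j %/ K n).
Definition sub_len n := (b n * K n)%N.
Local Notation q := sub_len.

Fixpoint height n := if n is n'.+1 then (q n' * height n')%N else 1%N.
Local Notation h := height.

Lemma sub_len_gt1 n : (1 < q n)%N.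
Proof. by have := K_gt0 n; have := cod_b cod n; rewrite /q; nia. Qed.

Lemma sub_len_gt0 n : (0 < q n)%N. Proof. exact: ltnW (sub_len_gt1 n). Qed.

Lemma height_gt0 n : (0 < h n)%N.
Proof. by elim: n => //= n IH; rewrite muln_gt0 sub_len_gt0. Qed.

Lemma height_gtn n : (n < h n)%N.
Proof. by elim: n => //= n IH; have := sub_len_gt1 n; nia. Qed.

Lemma sigma_index n j : (j < q n)%N -> (j %/ K n < b n)%N.
Proof. by rewrite ltn_divLR. Qed.

Lemma sigma_lt n a j : (a < l n.+1)%N -> (j < q n)%N -> (sigma n a j < l n)%N.
Proof.
move=> al /sigma_index jq; rewrite -(cod_letter cod _ al) mem_nth //.
by rewrite (cod_size cod).
Qed.

Lemma sigma_first n a : (a < l n.+1)%N -> sigma n a 0 = 0%N.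
Proof. by move=> al; rewrite /sigma div0n (cod_first cod). Qed.

Lemma sigma_last n a : (a < l n.+1)%N -> sigma n a (q n).-1 = (l n).-1.
Proof.
move=> al; rewrite /sigma -(cod_last cod al); congr nth.
have := cod_b cod n; have := K_gt0 n; rewrite /q => k0 b1.
have -> : (b n * K n).-1 = ((b n).-1 * K n + (K n).-1)%N by nia.
by rewrite divnMDl // divn_small ?addn0; lia.
Qed.

Lemma sigma_marker n a j : (a < l n.+1)%N -> (j.+1 < q n)%N ->
  sigma n a j = (l n).-1 -> sigma n a j.+1 <> 0%N.
Proof.
move=> al jq; rewrite /sigma.
have : (j.+1 %/ K n = j %/ K n \/ j.+1 %/ K n = (j %/ K n).+1)%N.
  by rewrite divnS //; case: (_ %| _)%N; [right|left]; rewrite ?add1n ?add0n.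
case=> jE; rewrite jE => e; first by have := cod_l cod n; lia.
by apply: (cod_marker cod al) e; rewrite -jE; apply: sigma_index.
Qed.

Lemma sigma_inj n a a' : (a < l n.+1)%N -> (a' < l n.+1)%N ->
  (forall j, (j < q n)%N -> sigma n a j = sigma n a' j) -> a = a'.
Proof.
move=> al al' e; apply: (cod_inj cod al al').
apply: (@eq_from_nth _ 0%N) => [|i]; rewrite !(cod_size cod) // => ib.
have /e : (i * K n < q n)%N by rewrite ltn_mul2r K_gt0.
by rewrite /sigma mulnK.
Qed.

Lemma sigma_occurs n a c : (a < l n.+1)%N -> (c < l n)%N ->
  exists2 j, (j < q n)%N & sigma n a j = c.
Proof.
move=> al; rewrite -(cod_letter cod _ al) => /(nthP 0%N)[i].
rewrite (cod_size cod) // => ib ci; exists (i * K n)%N.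
  by rewrite ltn_mul2r K_gt0.
by rewrite /sigma mulnK.
Qed.

(** Applying m substitutions to the bi-infinite seed with 0 at the nonnegative
    positions and the last letter at the negative ones.  Only the letters around
    the origin matter: since all words start with 0 and end with the last letter,
    position k is final after |k| steps. *)
Fixpoint letter_approx m n (k : int) : nat :=
  if m is m'.+1
  then sigma n (letter_approx m' n.+1 (k %/ (q n)%:Z)%Z) (absz (k %% (q n)%:Z)%Z)
  else if 0 <= k then 0%N else (l n).-1.

Definition level_letter n k := letter_approx (absz k) n k.
Local Notation z := level_letter.

Lemma letter_approxS m n (t : int) (r : nat) : (r < q n)%N ->
  letter_approx m.+1 n (t * (q n)%:Z + r%:Z) = sigma n (letter_approx m n.+1 t) r.
Proof. by move=> rq /=; have [-> ->] := divmod_intE t rq. Qed.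

Lemma letter_approx_lt m n k : (letter_approx m n k < l n)%N.
Proof.
elim: m n k => [|m IH] n k; first by have := cod_l cod n; rewrite /=; case: ifP; lia.
have [t [r [-> rq]]] := divmod_int k (sub_len_gt0 n).
by rewrite letter_approxS // sigma_lt.
Qed.

Lemma letter_approx0 m n : letter_approx m n 0 = 0%N.
Proof.
elim: m n => // m IH n; have := @letter_approxS m n 0 0 (sub_len_gt0 n).
by rewrite mul0r addr0 IH sigma_first // (ltnW (cod_l cod _)).
Qed.

Lemma letter_approxN1 m n : letter_approx m n (-1) = (l n).-1.
Proof.
elim: m n => // m IH n; have := sub_len_gt0 n => q0.
have -> : -1 = -1 * (q n)%:Z + (q n).-1%:Z by lia.
rewrite letter_approxS ?IH ?sigma_last //; last by lia.
by have := cod_l cod n.+1; lia.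
Qed.

Lemma letter_approx_stable m n k : (absz k <= m)%N ->
  letter_approx m.+1 n k = letter_approx m n k.
Proof.
elim: m n k => [|m IH] n k km.
  have -> : k = 0 by lia.
  by rewrite !letter_approx0.
have [->|k1] := eqVneq k (-1); first by rewrite !letter_approxN1.
have [t [r [kE rq]]] := divmod_int k (sub_len_gt0 n).
rewrite kE (letter_approxS m.+1 t rq) (letter_approxS m t rq) IH //; have := sub_len_gt1 n; nia.
Qed.

Lemma letter_approxE m n k : (absz k <= m)%N -> letter_approx m n k = z n k.
Proof.
move=> /subnK <-; elim: (_ - _)%N => // i IH.
by rewrite addSn letter_approx_stable // leq_addl.
Qed.

Lemma level_letter_lt n k : (z n k < l n)%N. Proof. exact: letter_approx_lt. Qed.

Lemma level_letter_sigma n (t : int) (r : nat) : (r < q n)%N ->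
  z n (t * (q n)%:Z + r%:Z) = sigma n (z n.+1 t) r.
Proof.
move=> rq; rewrite -(@letter_approxE (absz (t * (q n)%:Z + r%:Z) + absz t).+1); last by lia.
by rewrite letter_approxS // letter_approxE //; lia.
Qed.

Definition base_seq (i : int) : nat := z 0 i.
Local Notation x := base_seq.

(** Recognizability by a local rule: the word of a starts at position i when its
    letters follow and the preceding letter of the lower level is the last one.
    Being meaningful for every sequence, and depending on a bounded window only,
    the rule passes from the limit sequence to the subshift. *)
Fixpoint block_at n (y : int -> nat) (i : int) (a : nat) : Prop :=
  if n is n'.+1 then
    [/\ (a < l n)%N, block_at n' y (i - (h n')%:Z) (l n').-1
      & forall j, (j < q n')%N -> block_at n' y (i + (j * h n')%:Z) (sigma n' a j)]
  else y i = a.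

Lemma block_atS n y i a : block_at n.+1 y i a ->
  [/\ (a < l n.+1)%N, block_at n y (i - (h n)%:Z) (l n).-1
    & forall j, (j < q n)%N -> block_at n y (i + (j * h n)%:Z) (sigma n a j)].
Proof. by []. Qed.

(** The local rule is exact on the limit sequence: by the marker property a last
    letter followed by 0 forces i to be a boundary, and the letters that follow
    determine a by injectivity of the words. *)
Lemma base_seq_block n i a :
  block_at n x i a <-> exists2 k, i = k * (h n)%:Z & z n k = a.
Proof.
elim: n i a => [|n IH] i a /=.
  by rewrite /x; split=> [<-|[k -> <-]]; [exists i => //|]; rewrite mulr1.
have q0 := sub_len_gt0 n; have h0 := height_gt0 n.
have hn0 : (h n)%:Z != 0 by lia.
split=> [[al /IH[k0 k0E zk0] H]|[k -> <-]].
  have /IH[k kE zk] := H 0%N q0.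
  have {k0E} k0E : k0 = k - 1 by apply: (mulIf hn0); rewrite -k0E mulrBl -kE; lia.
  have iE : i = k * (h n)%:Z by rewrite -kE mul0n addr0.
  rewrite sigma_first // in zk.
  have [t [r [ktr rq]]] := divmod_int k q0.
  case: r => [|r] in ktr rq *.
    exists t; first by rewrite iE ktr; lia.
    apply: (sigma_inj (level_letter_lt n.+1 t) al) => j jq.
    have /IH[k' k'E zk'] := H j jq; rewrite -zk'.
    have -> : k' = t * (q n)%:Z + j%:Z by apply: (mulIf hn0); rewrite -k'E iE ktr; lia.
    by rewrite level_letter_sigma.
  have [] := sigma_marker (level_letter_lt n.+1 t) rq.
    by rewrite -level_letter_sigma 1?ltnW // -zk0 k0E ktr; congr z; lia.
  by rewrite -level_letter_sigma // -ktr.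
split; first exact: level_letter_lt.
  apply/IH; exists (k * (q n)%:Z - 1); first by lia.
  have -> : k * (q n)%:Z - 1 = (k - 1) * (q n)%:Z + (q n).-1%:Z by lia.
  by rewrite level_letter_sigma ?sigma_last ?level_letter_lt //; lia.
move=> j jq; apply/IH; exists (k * (q n)%:Z + j%:Z); first by lia.
by rewrite level_letter_sigma.
Qed.

Lemma block_at_shift n y m i a :
  block_at n (fun i => y (i + m)) i a <-> block_at n y (i + m) a.
Proof.
elim: n i a => //= n IH i a.
split=> -[al H1 H2]; split=> //.
- by move/IH: H1; rewrite addrAC.
- by move=> j /H2/IH; rewrite addrAC.
- by apply/IH; rewrite addrAC.
- by move=> j /H2 ?; apply/IH; rewrite addrAC.
Qed.

(** A radius 2 h n suffices at every level because h n + 2 h n and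
    (q n - 1) h n + 2 h n are at most 2 h (n+1). *)
Lemma block_at_local n y y' i a :
  (forall j : int, `|j| <= (2 * h n)%:Z -> y' (i + j) = y (i + j)) ->
  block_at n y i a -> block_at n y' i a.
Proof.
elim: n i a => [|n IH] i a; first by move=> /(_ 0); rewrite addr0 /= => ->.
have := sub_len_gt1 n; have := height_gt0 n => h0 q1 /= H [al H1 H2]; split=> //.
  apply: IH H1 => j jn; rewrite -!addrA; apply: H; nia.
move=> j jq; apply: IH (H2 j jq) => k kn; rewrite -!addrA; apply: H; nia.
Qed.

(** Letter j of the image of the level n letter a under sigma_0 o ... o
    sigma_(n-1). *)
Fixpoint block_word n a j : nat :=
  if n is n'.+1 then block_word n' (sigma n' a (j %/ h n')%N) (j %% h n')%N else a.

Lemma block_at_word n y i a j : block_at n y i a -> (j < h n)%N ->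
  y (i + j%:Z) = block_word n a j.
Proof.
elim: n i a j => [|n IH] i a j /=.
  by rewrite ltnS leqn0 => ya /eqP->; rewrite addr0.
case=> _ _ H jh; have h0 := height_gt0 n.
have jq : (j %/ h n < q n)%N by rewrite ltn_divLR.
rewrite -(IH (i + (j %/ h n * h n)%:Z)) ?ltn_mod //; last exact: H.
by rewrite -addrA -PoszD -divn_eq.
Qed.

Lemma base_seq_word n (k : int) j : (j < h n)%N ->
  x (k * (h n)%:Z + j%:Z) = block_word n (z n k) j.
Proof. by apply: block_at_word; apply/base_seq_block; exists k. Qed.

(** A boundary of level n+1 is preceded by the level n word of the last letter and
    followed by the level n word of 0, whatever the letters on both sides are.
    Periodicity of the limit sequence, minimality and the vanishing of
    coboundaries all rest on this. *)
Lemma cut_window n y y' i i' a a' (j : int) :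
  block_at n.+1 y i a -> block_at n.+1 y' i' a' ->
  - (h n)%:Z <= j < (h n)%:Z -> y' (i' + j) = y (i + j).
Proof.
move=> /block_atS[al H1 /(_ 0%N (sub_len_gt0 n))]; rewrite mul0n addr0 sigma_first // => H2.
move=> /block_atS[al' H1' /(_ 0%N (sub_len_gt0 n))]; rewrite mul0n addr0 sigma_first // => H2' jh.
have [j0|j0] := leP 0 j.
  have -> : j = (absz j)%:Z by lia.
  have jh' : (absz j < h n)%N by lia.
  by rewrite (block_at_word H2) // (block_at_word H2').
have jE k : k + j = k - (h n)%:Z + (absz (j + (h n)%:Z))%:Z by lia.
have jh' : (absz (j + (h n)%:Z)%R < h n)%N by lia.
by rewrite !jE (block_at_word H1) // (block_at_word H1').
Qed.

(** The orbit closure, through finite windows. *)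
Definition hull : set (int -> nat) :=
  [set y | forall W : nat, exists m : int,
     forall i : int, `|i| <= W%:Z -> y i = x (i + m)].

Lemma hull_shift y m : hull y -> hull (fun i => y (i + m)).
Proof.
move=> yY W; have [m' H] := yY (W + absz m)%N.
by exists (m + m') => i iW; rewrite H ?addrA //; lia.
Qed.

Lemma hull_base_seq m : hull (fun i => x (i + m)).
Proof. by move=> W; exists m. Qed.

Lemma hull_block y n B : hull y -> exists m : int, forall (i : int) a,
  `|i| <= B%:Z ->
  block_at n y i a <-> exists2 k, i + m = k * (h n)%:Z & z n k = a.
Proof.
move=> yY; have [m H] := yY (B + 2 * h n)%N; exists m => i a iB.
rewrite -base_seq_block -block_at_shift; split; apply: block_at_local => j jn.
  by rewrite H //; lia.
by rewrite H //; lia.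
Qed.

Lemma tower_exists y n : hull y ->
  exists a j, [/\ (a < l n)%N, (j < h n)%N & block_at n y (- j%:Z) a].
Proof.
move=> /(@hull_block y n (h n))[m H].
have [t [r [mE rh]]] := divmod_int m (height_gt0 n).
exists (z n t), r; split=> //; first exact: level_letter_lt.
by apply/H; [lia|exists t => //; lia].
Qed.

Lemma tower_unique y n (i i' : int) a a' : hull y ->
  block_at n y i a -> block_at n y i' a' -> `|i - i'| < (h n)%:Z ->
  i = i' /\ a = a'.
Proof.
move=> /(@hull_block y n (absz i + absz i'))[m H] /H H1 /H H2 ii'.
have [|k iE <-] := H1; first by lia.
have [|k' iE' <-] := H2; first by lia.
have kk' : k = k'.
  have e : (k - k') * (h n)%:Z = i - i' by rewrite mulrBl -iE -iE'; lia.
  have := height_gt0 n; case: (ltgtP k k') => // kk h0.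
    by have : (k' - k - 1) * (h n)%:Z >= 0 by [nia]; lia.
  by have : (k - k' - 1) * (h n)%:Z >= 0 by [nia]; lia.
by rewrite kk'; split=> //; move: iE iE'; rewrite kk'; lia.
Qed.

Lemma tower_next y n i a : hull y -> block_at n y i a ->
  exists2 a', (a' < l n)%N & block_at n y (i + (h n)%:Z) a'.
Proof.
move=> /(@hull_block y n (absz i + h n))[m H] /H[|k iE _]; first by lia.
exists (z n (k + 1)); first exact: level_letter_lt.
by apply/H; [lia|exists (k + 1) => //; lia].
Qed.

Lemma letter_occurs n a : (a < l n)%N -> exists k, z n k = a.
Proof.
move=> al; have [j jq <-] := sigma_occurs (level_letter_lt n.+1 0) al.
by exists (0 * (q n)%:Z + j%:Z); rewrite level_letter_sigma.
Qed.

End ToeplitzSequence.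

(** * The Toeplitz subshift and its minimality *)
Section ToeplitzSubshift.
Variables (l b K : nat -> nat) (om : nat -> nat -> seq nat).
Hypothesis cod : coding l b om.
Hypothesis K_gt0 : forall n, (0 < K n)%N.
Local Notation sigma := (sigma K om).
Local Notation q := (sub_len b K).
Local Notation h := (height b K).
Local Notation z := (level_letter l b K om).
Local Notation block_at := (block_at l b K om).
Local Notation hull := (hull l b K om).
Local Notation A := 'I_(l 0).

Definition word_of (y : full_shift A) : int -> nat := fun i => y i : A.

Definition toeplitz_point : full_shift A := fun i => Ordinal (level_letter_lt cod K_gt0 0 i).

Definition toeplitz_set : set (full_shift A) := [set y | hull (word_of y)].

Lemma toeplitz_setP y : toeplitz_set y <->
  forall W, exists m, forall i : int, `|i| <= W%:Z -> y i = toeplitz_point (i + m).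
Proof.
split=> H W; have [m Hm] := H W; exists m => i iW.
  by apply: val_inj; exact: Hm.
by rewrite /word_of Hm.
Qed.

Lemma iter_shift m (y : full_shift A) : iter m (@Defs.shift A) y = fun i => y (i + m%:Z).
Proof.
elim: m => [|m IH]; first by apply/funext => i; rewrite addr0.
by rewrite iterS IH; apply/funext => i; rewrite /Defs.shift; congr y; lia.
Qed.

Lemma orbit_shiftP (y y' : full_shift A) :
  Defs.orbit (@Defs.shift A) y y' <-> exists m : int, y' = fun i => y (i + m).
Proof.
split=> [[n [->|->]]|[m ->]].
- by exists n%:Z; rewrite iter_shift.
- by exists (- n%:Z); rewrite iter_shift; apply/funext => i; rewrite addrNK.
- exists (absz m); have [m0|m0] := leP 0 m; [left|right]; rewrite iter_shift.
    by apply/funext => i; congr y; lia.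
  by apply/funext => i; congr y; lia.
Qed.

Lemma toeplitz_set_closure :
  toeplitz_set = closure (Defs.orbit (@Defs.shift A) toeplitz_point).
Proof.
apply/seteqP; split=> y.
  move=> /toeplitz_setP H; apply/closureP => W; have [m Hm] := H W.
  exists (fun i => toeplitz_point (i + m)); first by apply/orbit_shiftP; exists m.
  by move=> i /Hm.
move=> /closureP H; apply/toeplitz_setP => W.
by have [y' /orbit_shiftP[m ->] Hm] := H W; exists m => i /Hm.
Qed.

Lemma toeplitz_set_closed : closed toeplitz_set.
Proof. by rewrite toeplitz_set_closure; exact: closed_closure. Qed.

Lemma toeplitz_set_shift m (y : full_shift A) :
  toeplitz_set y -> toeplitz_set (fun i => y (i + m)).
Proof. exact: (hull_shift (y := word_of y)). Qed.

Lemma toeplitz_set_invariant : @Defs.shift A @` toeplitz_set = toeplitz_set.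
Proof.
apply/seteqP; split=> [y [y' Yy' <-]|y Yy]; first exact: toeplitz_set_shift.
exists (fun i => y (i - 1)); first exact: toeplitz_set_shift.
by apply/funext => i; rewrite /Defs.shift addrK.
Qed.

Definition toeplitz_subshift : subshift A :=
  Subshift toeplitz_set_closed toeplitz_set_invariant.
Local Notation Y := toeplitz_subshift.
Local Notation T := (@subshift_map A Y).

Definition read_point (y : subshift_space Y) : int -> nat := word_of (set_val y).

Lemma read_point_hull y : hull (read_point y).
Proof. exact: (set_valP y). Qed.

Definition orbit_pt_fun (m : int) : full_shift A := fun i => toeplitz_point (i + m).
Lemma orbit_pt_mem m : orbit_pt_fun m \in subshift_set Y.
Proof. by apply/mem_set; apply: (hull_base_seq l b K om m). Qed.
Definition orbit_pt m : subshift_space Y := exist _ (orbit_pt_fun m) (orbit_pt_mem m).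

Lemma read_orbit_pt m : read_point (orbit_pt m) = fun i => base_seq l b K om (i + m).
Proof. by []. Qed.

Lemma read_point_map y : read_point (T y) = fun i => read_point y (i + 1).
Proof. by []. Qed.

Lemma map_orbit_pt m : T (orbit_pt m) = orbit_pt (m + 1).
Proof.
apply/val_inj/funext => i; rewrite /= /orbit_pt_fun /Defs.shift /=.
by congr toeplitz_point; lia.
Qed.

Lemma orbit_pt_block n k r :
  block_at n (read_point (orbit_pt (k * (h n)%:Z + r%:Z))) (- r%:Z) (z n k).
Proof.
rewrite read_orbit_pt; apply/block_at_shift/(base_seq_block cod K_gt0).
by exists k => //; lia.
Qed.

(** Windows around 0 of radius h n recur with period h (n+1), since every
    multiple of h (n+1) is a boundary of level n+1. *)
Lemma toeplitz_point_window n (j k : int) : - (h n)%:Z <= j < (h n)%:Z ->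
  toeplitz_point (j + k * (h n.+1)%:Z) = toeplitz_point j.
Proof.
move=> jh; apply: val_inj => /=; rewrite -!/(base_seq l b K om _) addrC.
have B (t : int) : block_at n.+1 (base_seq l b K om) (t * (h n.+1)%:Z) (z n.+1 t).
  by apply/(base_seq_block cod K_gt0); exists t.
have := cut_window cod K_gt0 (B 0) (B k) jh.
by rewrite mul0r add0r.
Qed.

Lemma toeplitz_subshift_toeplitz : is_toeplitz_subshift Y.
Proof.
exists toeplitz_point; split; last exact: toeplitz_set_closure.
move=> i; exists (h (absz i).+1); split=> [|k]; first exact: (height_gt0 cod K_gt0).
apply/esym/toeplitz_point_window.
have := height_gtn cod K_gt0 (absz i); lia.
Qed.

(** A window of any point occurs in the limit sequence, thus inside [-h n, h n)
    for some n, and every point of the subshift shows that window at each of its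
    boundaries of level n+1. *)
Lemma toeplitz_subshift_minimal : minimal_system T.
Proof.
move=> y O [y0 Oy0] oO.
have /subshift_nbhsP[W HW] : nbhs y0 O by exact: open_nbhs_nbhs (conj oO Oy0).
have Yval (y1 : subshift_space Y) : toeplitz_set (set_val y1) := set_valP y1.
have [m Hm] := (toeplitz_setP _).1 (Yval y0) W.
pose n := (W + absz m)%N; have nh := height_gtn cod K_gt0 n.
have [a [j [al jh Ba]]] := tower_exists cod K_gt0 n.+1 (read_point_hull y).
pose t := - j%:Z + m.
pose yt : subshift_space Y :=
  exist _ (fun i => set_val y (i + t)) (mem_set (toeplitz_set_shift t (Yval y))).
exists yt; split.
  apply: HW => i iW; rewrite Hm //=; apply: val_inj => /=.
  have B0 : block_at n.+1 (base_seq l b K om) 0 (z n.+1 0).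
    by apply/(base_seq_block cod K_gt0); exists 0.
  have im : - (h n)%:Z <= i + m < (h n)%:Z by lia.
  have := cut_window cod K_gt0 B0 Ba im; rewrite add0r /base_seq => <-.
  by rewrite /read_point /word_of /t; congr (nat_of_ord (set_val y _)); lia.
have iterT k (y' : subshift_space Y) :
    set_val (iter k T y') = fun i => set_val y' (i + k%:Z).
  rewrite -iter_shift; elim: k => // k IH; by rewrite !iterS -IH.
exists (absz t); have [t0|t0] := leP 0 t; [left|right]; apply/val_inj/funext => i.
  rewrite [RHS](congr1 (fun f => f i) (iterT _ _)) /=; congr (set_val y _); lia.
rewrite [RHS](congr1 (fun f => f i) (iterT _ _)) /=; congr (set_val y _); lia.
Qed.

End ToeplitzSubshift.

(** * Complexity *)
Section Complexity.
Variables (l b K : nat -> nat) (om : nat -> nat -> seq nat).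
Hypothesis cod : coding l b om.
Hypothesis K_gt0 : forall n, (0 < K n)%N.
Local Notation h := (height b K).
Local Notation q := (sub_len b K).
Local Notation z := (level_letter l b K om).
Local Notation block_word := (block_word b K om).
Local Notation Y := (toeplitz_subshift cod K_gt0).
Local Notation A := 'I_(l 0).

Lemma toeplitz_blocks (y : full_shift A) i k : subshift_set Y y ->
  exists m, block y i k = block (toeplitz_point cod K_gt0) m k.
Proof.
move=> /toeplitz_setP/(_ (absz i + k)%N)[m Hm]; exists (i + m).
apply: eq_from_tnth => j; rewrite !tnth_mktuple Hm; last by have := ltn_ord j; lia.
by congr toeplitz_point; lia.
Qed.

(** When the level n letters are constant on blocks of L positions, a factor of
    length k <= L h n meets at most two blocks.  It is determined by their two
    letters and by the position of the change relative to the factor, which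
    ranges over k + h n values: a factor with no change is placed right after a
    fictitious one, at one of h n possible offsets. *)
Lemma complexity_le n L (w : int -> nat) k :
  (0 < L)%N -> (forall t, (w t < l n)%N) ->
  (forall (t : int) r, (r < L)%N -> z n (t * L%:Z + r%:Z) = w t) ->
  (0 < k <= L * h n)%N -> (complexity Y k <= l n * l n * (k + h n))%N.
Proof.
move=> L0 wl wE /andP[k0 kL]; have h0 := height_gt0 cod K_gt0 n.
pose a0 : A := toeplitz_point cod K_gt0 0.
pose V := ('I_(l n) * 'I_(l n) * 'I_(k + h n))%type.
(* v.2 - h n is the position of the change inside the factor; it is at most 0
   when the factor lies entirely in the second block. *)
pose Fl (v : V) (t : nat) : nat :=
  let e := t%:Z - ((v.2 : nat)%:Z - (h n)%:Z) in
  block_word n (if e < 0 then v.1.1 : nat else v.1.2 : nat) (absz (e %% (h n)%:Z)%Z).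
pose F (v : V) : k.-tuple A := [tuple insubd a0 (Fl v t) | t < k].
have -> : (l n * l n * (k + h n) = #|[set: V]%SET|)%N.
  by rewrite cardsT !card_prod !card_ord.
apply: leq_trans (leq_imset_card F _).
apply: subset_leq_card; apply/fintype.subsetP => W.
move=> /asboolP[y [Yy [i ->]]]; have [m ->] := toeplitz_blocks i k Yy.
have Lh0 : (0 < L * h n)%N by rewrite muln_gt0 L0.
have [s [r [mE rL]]] := divmod_int m Lh0.
have xE e : (e < L * h n + L * h n)%N ->
    base_seq l b K om (s * (L * h n)%:Z + e%:Z) =
    block_word n (if (e < L * h n)%N then w s else w (s + 1)) (e %% h n)%N.
  move=> eL; have eE := divn_eq e (h n); have em := ltn_pmod e h0.
  have [e1|e1] := ltnP e (L * h n).
    have dL : (e %/ h n < L)%N by rewrite ltn_divLR.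
    rewrite -(wE s _ dL) -(base_seq_word cod K_gt0) //; congr base_seq; rewrite [in LHS]eE; lia.
  have dL : (e %/ h n - L < L)%N.
    have : (e %/ h n < L + L)%N by rewrite ltn_divLR // mulnDl.
    by lia.
  have Ld : (L <= e %/ h n)%N by rewrite leq_divRL.
  rewrite -(wE (s + 1) _ dL) -(base_seq_word cod K_gt0) //; congr base_seq; rewrite [in LHS]eE.
  by rewrite -{1}(subnK Ld); lia.
have found (v : V) :
    (forall t, (t < k)%N -> base_seq l b K om (m + t%:Z) = Fl v t) ->
    block (toeplitz_point cod K_gt0) m k \in (F @: [set: V])%SET.
  move=> H; apply/imsetP; exists v => //; apply: eq_from_tnth => t.
  rewrite !tnth_mktuple -(H t (ltn_ord t)).
  by rewrite -[LHS](valKd a0).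
have modE (e : nat) (t : int) : t = e%:Z %[mod (h n)%:Z]%Z ->
    absz (t %% (h n)%:Z)%Z = (e %% h n)%N by move=> ->; rewrite modz_nat.
have [rk|rk] := leqP (r + k) (L * h n).
  have vk : (h n - r %% h n < k + h n)%N by lia.
  apply: (found (Ordinal (wl s), Ordinal (wl s), Ordinal vk)) => t tk.
  have rh := ltn_pmod r h0.
  rewrite /Fl /= if_same mE -addrA -PoszD xE; last by lia.
  have -> : (r + t < L * h n)%N by lia.
  congr block_word; apply/esym/modE.
  have -> : t%:Z - ((h n - r %% h n)%N%:Z - (h n)%:Z) = (t + r %% h n)%N%:Z by lia.
  by rewrite !modz_nat modnDmr addnC.
have vk : (L * h n - r + h n < k + h n)%N by lia.
apply: (found (Ordinal (wl s), Ordinal (wl (s + 1)), Ordinal vk)) => t tk.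
rewrite /Fl /= mE -addrA -PoszD xE; last by lia.
have -> : (t%:Z - ((L * h n - r + h n)%N%:Z - (h n)%:Z) < 0) = (r + t < L * h n)%N by lia.
congr block_word; apply/esym/modE.
have -> : (r + t)%N%:Z =
  L%:Z * (h n)%:Z + (t%:Z - ((L * h n - r + h n)%N%:Z - (h n)%:Z)) by lia.
by rewrite modzMDl.
Qed.

(** The multiplicities K do not enter: this is what allows them to be
    chosen after these factors. *)
Definition complexity_factor n := (2 * l n * l n + l n.+1 * l n.+1 * (b n).+1)%N.

(** Up to K n h n the level n letters, constant on blocks of K n positions, are
    used; beyond, those of level n+1, where h (n+1) = b n (K n h n) <= b n k. *)
Lemma complexity_linear n k : (h n <= k <= h n.+1)%N ->
  (complexity Y k <= complexity_factor n * k)%N.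
Proof.
move=> /andP[hk kh]; have h0 := height_gt0 cod K_gt0 n; have K0 := K_gt0 n.
have k0 : (0 < k)%N by exact: leq_trans hk.
have [kK|kK] := leqP k (K n * h n).
  apply: (leq_trans (@complexity_le n (K n) (fun t => z n (t * (K n)%:Z)) k _ _ _ _)) => //.
  - by move=> t; apply: level_letter_lt.
  - move=> t r rK; have b0 : (0 < b n)%N by have := cod_b cod n; lia.
    have [t1 [t2 [-> t2b]]] := divmod_int t b0.
    have tq : (t2 * K n + r < q n)%N by rewrite /q; nia.
    have -> : (t1 * (b n)%:Z + t2%:Z) * (K n)%:Z + r%:Z =
      t1 * (q n)%:Z + (t2 * K n + r)%N%:Z by rewrite /q; lia.
    have -> : (t1 * (b n)%:Z + t2%:Z) * (K n)%:Z =
      t1 * (q n)%:Z + (t2 * K n)%N%:Z by rewrite /q; lia.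
    rewrite !(level_letter_sigma cod K_gt0) //; last by lia.
    by rewrite /sigma divnMDl // mulnK // divn_small // addn0.
  - by rewrite k0.
  - by rewrite /complexity_factor; nia.
apply: (leq_trans (@complexity_le n.+1 1 (z n.+1) k _ _ _ _)) => //.
- by move=> t; apply: level_letter_lt.
- by move=> t [|//] _; rewrite mulr1 addr0.
- by rewrite k0 mul1n.
- have : (h n.+1 <= b n * k)%N by rewrite /= /q -mulnA leq_mul // ltnW.
  by rewrite /complexity_factor; move: (h n.+1) => hn; nia.
Qed.

End Complexity.

(** * Letting the ratio tend to 0 *)
Section Asymptotics.
Variables (R : realType) (p : nat -> R).
Hypothesis p_gt0 : forall n, 0 < p n.
Hypothesis p_lim : (n%:R / p n) @[n --> \oo] --> (0 : R).

Lemma superlinear_thresholds (C : nat -> nat) : exists t : nat -> nat,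
  forall n k, (t n <= k)%N -> (C n * k)%:R / p k <= n.+1%:R^-1.
Proof.
suff H n : exists t, forall k, (t <= k)%N -> (C n * k)%:R / p k <= n.+1%:R^-1.
  by have [t Ht] := choice H; exists t.
have e0 : 0 < (n.+1%:R^-1 / (C n).+1%:R : R) by rewrite divr_gt0 ?invr_gt0 ?ltr0n.
have [N _ HN] := (cvgr0Pnorm_le _).1 p_lim _ e0.
exists N => k /HN /=; rewrite ger0_norm ?divr_ge0 ?ler0n ?(ltW (p_gt0 _)) // => Hk.
rewrite natrM -mulrA.
apply: le_trans (_ : (C n).+1%:R * (n.+1%:R^-1 / (C n).+1%:R) <= _); last first.
  by rewrite mulrCA mulfV ?mulr1 // pnatr_eq0.
apply: ler_pM; rewrite ?ler0n ?ler_nat // divr_ge0 ?ler0n ?(ltW (p_gt0 _)) //.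
Qed.

Lemma ratio_cvg0 (C t h c : nat -> nat) :
  (forall n k, (t n <= k)%N -> (C n * k)%:R / p k <= n.+1%:R^-1) ->
  (forall n, (t n.+1 <= h n.+1)%N) -> (forall n, (n < h n)%N) ->
  (forall n, (h n <= h n.+1)%N) ->
  (forall n k, (h n <= k <= h n.+1)%N -> (c k <= C n * k)%N) ->
  (c n)%:R / p n @[n --> \oo] --> (0 : R).
Proof.
move=> Ht th hn hm Hc; apply/cvgr0Pnorm_le => e e0.
have [N HN] : exists N : nat, N.+1%:R^-1 <= e.
  have [N _ HN] := near_infty_natSinv_lt (PosNum e0).
  by exists N; apply/ltW/(HN N)/leqnn.
exists (h N.+1) => // k /= hk.
rewrite ger0_norm ?divr_ge0 ?ler0n ?(ltW (p_gt0 _)) //.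
have ex : exists n, (k < h n)%N by exists k.
case: (ex_minnP ex) => n kn minn.
have {}hm : {homo h : i j / (i <= j)%N} by apply: homo_leq => //; exact: leq_trans.
case: n => [|n] in kn minn *.
  by have := hm 0%N N.+1 isT; lia.
have hnk : (h n <= k)%N by rewrite leqNgt; apply/negP => /minn; lia.
have Nn : (N < n)%N.
  by rewrite ltnNge; apply/negP => nN; have := hm n.+1 N.+1 nN; lia.
apply: le_trans (_ : n.+1%:R^-1 <= _); last first.
  by apply: le_trans HN; rewrite lef_pV2 ?posrE ?ltr0n // ler_nat; lia.
have tn : (t n <= h n)%N by case: n Nn {hnk kn minn} => // n _; exact: th.
apply: le_trans (Ht n k (leq_trans tn hnk)).
by rewrite ler_pM2r ?invr_gt0 // ler_nat; apply: Hc; rewrite hnk ltnW.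
Qed.

End Asymptotics.

(** The data of an ordered group with unit as a limit of the matrices M: [g n c] plays the role of the class of the base of tower c at stage n. *)
Record tower_model (G : zmodType) (P : set G) (u : G) (l : nat -> nat)
  (M : nat -> nat -> nat -> nat) (g : nat -> nat -> G) : Prop := TowerModel {
  tm_pos : forall n c, (c < l n)%N -> P (g n c);
  tm_step : forall n c, (c < l n)%N ->
    g n c = \sum_(a < l n.+1) g n.+1 a *+ M n a c;
  tm_unit : u = \sum_(c < l 0) g 0 c;
  tm_surj : forall v, P v -> exists n (s : nat -> nat),
    v = \sum_(c < l n) g n c *+ s c;
  tm_ker : forall n (s : nat -> nat -> int),
    (forall k a, (n <= k)%N -> (a < l k.+1)%N ->
       s k.+1 a = \sum_(c < l k) s k c *+ M k a c) ->
    \sum_(c < l n) g n c *~ s n c = 0 ->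
    exists2 k, (n <= k)%N & forall a, (a < l k)%N -> s k a = 0
}.

(** * The dynamical dimension group *)
Lemma cone_sum (G : zmodType) (P : set G) (g : nat -> G) (s : nat -> int) n :
  P 0 -> (forall a a', P a -> P a' -> P (a + a')) ->
  (forall a, (a < n)%N -> P (g a)) -> (forall a, (a < n)%N -> 0 <= s a) ->
  P (\sum_(a < n) g a *~ s a).
Proof.
move=> P0 PD gP s0; apply: (big_ind P) => // a _.
have := s0 a (ltn_ord a); case: (s a) => // m _; rewrite -pmulrn.
elim: m => [|m IH]; first by rewrite mulr0n.
by rewrite mulrS; apply: PD => //; apply: gP.
Qed.

Section DynamicalDimensionGroup.
Local Open Scope quotient_scope.
Variables (l b K : nat -> nat) (om : nat -> nat -> seq nat).
Hypothesis cod : coding l b om.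
Hypothesis K_gt0 : forall n, (0 < K n)%N.
Local Notation sigma := (sigma K om).
Local Notation q := (sub_len b K).
Local Notation h := (height b K).
Local Notation z := (level_letter l b K om).
Local Notation block_at := (block_at l b K om).
Local Notation Y := (toeplitz_subshift cod K_gt0).
Local Notation T := (@subshift_map _ Y).
Local Notation orbit_pt := (orbit_pt cod K_gt0).
Implicit Types (y : subshift_space Y) (f : CZ (subshift_space Y)).

(** Equal values at any two points at the same height j in the tower of the same
    letter a. *)
Definition level_constant n (f : CZ (subshift_space Y)) := forall y y' a j,
  (a < l n)%N -> (j < h n)%N -> block_at n (read_point y) (- j%:Z) a ->
  block_at n (read_point y') (- j%:Z) a -> CZ_val f y' = CZ_val f y.

Lemma level_constantS n f : level_constant n f -> level_constant n.+1 f.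
Proof.
move=> H y y' a j al jh /block_atS[_ _ B] /block_atS[_ _ B'].
have h0 := height_gt0 cod K_gt0 n.
have jq : (j %/ h n < q n)%N by rewrite ltn_divLR.
pose t := (j %/ h n)%N; pose r := (j %% h n)%N.
have jE : - j%:Z + (t * h n)%:Z = - r%:Z by have := divn_eq j (h n); rewrite -/t -/r; lia.
apply: (H y y' (sigma n a t) r); first exact: (sigma_lt cod K_gt0).
- exact: ltn_pmod.
- by rewrite -jE; apply: B.
- by rewrite -jE; apply: B'.
Qed.

Lemma level_constant_leq n m f : (n <= m)%N ->
  level_constant n f -> level_constant m f.
Proof.
by move=> /subnK <-; elim: (m - n)%N => // i IH /IH; exact: level_constantS.
Qed.

Lemma agree_read_point W y y' :
  (forall i : int, `|i| <= W%:Z -> read_point y' i = read_point y i) ->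
  agree W (set_val y) (set_val y').
Proof. by move=> H i iW; apply: val_inj; exact: H. Qed.

(** A window of radius W < h W fits: inside the tower the points agree, and near
    its two ends they agree by the window of radius h W around each boundary. *)
Lemma level_constant_exists f : exists n, level_constant n f.
Proof.
have [W HW] := CZ_window f; exists W.+1 => y y' a j al jh B B'.
apply/HW/agree_read_point => i iW.
have hW := height_gtn cod K_gt0 W.
have [ij0|ij0] := ltP (i + j%:Z) 0.
  have iE : i = - j%:Z + (i + j%:Z) by lia.
  by rewrite iE; apply: (cut_window cod K_gt0 B B'); lia.
have [ijh|ijh] := ltP (i + j%:Z) (h W.+1)%:Z.
  have iE : i = - j%:Z + (absz (i + j%:Z))%:Z by lia.
  have lt : (absz (i + j%:Z)%R < h W.+1)%N by lia.
  by rewrite iE (block_at_word cod K_gt0 B lt) (block_at_word cod K_gt0 B' lt).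
have [c _ C] := tower_next cod K_gt0 (read_point_hull y) B.
have [c' _ C'] := tower_next cod K_gt0 (read_point_hull y') B'.
have iE : i = - j%:Z + (h W.+1)%:Z + (i + j%:Z - (h W.+1)%:Z) by lia.
by rewrite iE; apply: (cut_window cod K_gt0 C C'); lia.
Qed.

(** All the bases of high enough towers look the same to f. *)
Lemma cut_constant f : exists n, forall m (k k' : int), (n <= m)%N ->
  CZ_val f (orbit_pt (k * (h m)%:Z)) = CZ_val f (orbit_pt (k' * (h m)%:Z)).
Proof.
have [W HW] := CZ_window f; exists W.+1 => -[//|m] k k' Wm.
apply/HW/agree_read_point => i iW; have hm := height_gtn cod K_gt0 m.
have := @orbit_pt_block _ _ _ _ cod K_gt0 m.+1 k 0.
have := @orbit_pt_block _ _ _ _ cod K_gt0 m.+1 k' 0.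
rewrite !addr0 => B B'; rewrite -[i]add0r.
by apply: (cut_window cod K_gt0 B B'); lia.
Qed.

Lemma tower_pos_exists n y : exists aj : nat * nat,
  [/\ (aj.1 < l n)%N, (aj.2 < h n)%N & block_at n (read_point y) (- aj.2%:Z) aj.1].
Proof.
by have [a [j ?]] := tower_exists cod K_gt0 n (read_point_hull y); exists (a, j).
Qed.
Definition tower_pos n y : nat * nat := sval (cid (tower_pos_exists n y)).

Lemma tower_posP n y :
  [/\ ((tower_pos n y).1 < l n)%N, ((tower_pos n y).2 < h n)%N
    & block_at n (read_point y) (- (tower_pos n y).2%:Z) (tower_pos n y).1].
Proof. exact: (svalP (cid (tower_pos_exists n y))). Qed.

Lemma tower_pos_eq n y a j : (j < h n)%N -> block_at n (read_point y) (- j%:Z) a ->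
  tower_pos n y = (a, j).
Proof.
move=> jh B; have [_ jh' B'] := tower_posP n y.
have [|] := tower_unique cod K_gt0 (read_point_hull y) B' B; first by lia.
by case: (tower_pos n y) => a' j' /= in jh' B' *; move=> e ->; congr pair; lia.
Qed.

Lemma tower_pos_pt n k r : (r < h n)%N -> tower_pos n (orbit_pt (k * (h n)%:Z + r%:Z)) = (z n k, r).
Proof. by move=> rh; apply: tower_pos_eq => //; exact: orbit_pt_block. Qed.

(** Tower coordinates depend on a bounded window only. *)
Lemma tower_fun_continuous n (phi : nat * nat -> int) :
  continuous ((fun y => phi (tower_pos n y)) : _ -> discrete_topology int).
Proof.
apply: (@window_continuous _ _ _ (3 * h n)%N) => y y' H; congr phi.
have [al jh B] := tower_posP n y; rewrite [RHS]surjective_pairing; apply: tower_pos_eq => //.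
apply: block_at_local B => // i ih; rewrite /read_point /word_of H //; lia.
Qed.
Definition tower_fun n phi : CZ (subshift_space Y) :=
  mkcts (@tower_fun_continuous n phi).

Lemma tower_funE n phi y : CZ_val (tower_fun n phi) y = phi (tower_pos n y).
Proof. by []. Qed.

Lemma tower_fun_level_constant n phi : level_constant n (tower_fun n phi).
Proof.
by move=> y y' a j al jh B B'; congr phi; rewrite (tower_pos_eq jh B) (tower_pos_eq jh B').
Qed.

(** A representative for each tower: any occurrence of a among the level n
    letters of the limit sequence. *)
Definition base_index n a : int := xget 0 [set k | z n k = a].

Lemma base_indexP n a : (a < l n)%N -> z n (base_index n a) = a.
Proof.
move=> /(letter_occurs cod K_gt0)[k zk].
exact: (@xgetPex _ 0 [set k | z n k = a]) (ex_intro _ k zk).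
Qed.

Definition tower_sum n f a : int :=
  \sum_(0 <= j < h n) CZ_val f (orbit_pt (base_index n a * (h n)%:Z + j%:Z)).

Lemma tower_sumS n f a : level_constant n f -> (a < l n.+1)%N ->
  tower_sum n.+1 f a = \sum_(0 <= t < q n) tower_sum n f (sigma n a t).
Proof.
move=> lev al; rewrite /tower_sum /= big_nat_mul.
rewrite !big_mkord; apply: eq_bigr => t _.
have h0 := height_gt0 cod K_gt0 n.
have sl : (sigma n a t < l n)%N by apply: (sigma_lt cod K_gt0).
rewrite -{1}[(t * h n)%N]add0n big_addn.
have -> : (t.+1 * h n - t * h n = h n)%N by rewrite mulSn addnK.
rewrite !big_mkord; apply: eq_bigr => r _.
pose k := base_index n.+1 a * (q n)%:Z + t%:Z.
have -> : base_index n.+1 a * (q n * h n)%N + (r + t * h n)%N =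
          k * (h n)%:Z + r%:Z by rewrite /k; lia.
apply: (lev _ _ (sigma n a t) r) => //.
  by rewrite -{2}(base_indexP sl); exact: orbit_pt_block.
have -> : sigma n a t = z n k by rewrite /k (level_letter_sigma cod K_gt0) // base_indexP.
exact: orbit_pt_block.
Qed.

Definition occ n a c : nat := (K n * count_mem c (om n a))%N.

(** The sum over the positions of a substitution word is regrouped by letters;
    the K n copies of each letter give the factor in the number of
    occurrences. *)
Lemma sum_letters n a (F : nat -> int) : (a < l n.+1)%N ->
  \sum_(0 <= t < q n) F (sigma n a t) = \sum_(c < l n) F c *+ occ n a c.
Proof.
move=> al; have K0 := K_gt0 n; rewrite big_nat_mul.
transitivity (\sum_(0 <= i < b n) F (nth 0%N (om n a) i) *+ K n).
  apply: eq_bigr => i _; rewrite big_nat.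
  under eq_bigr => j /andP[ji jK].
    have -> : sigma n a j = nth 0%N (om n a) i.
      congr nth; apply/eqP; rewrite eqn_leq -ltnS ltn_divLR // jK /=.
      by rewrite leq_divRL.
    over.
  by rewrite -big_nat sumr_const_nat mulSn addnK.
rewrite sumrMnl -(cod_size cod al) -(big_nth 0%N xpredT).
under [RHS]eq_bigr do rewrite /occ mulnC mulrnA.
rewrite sumrMnl; congr (_ *+ _).
have : all (fun c => c < l n)%N (om n a).
  by apply/allP => c; rewrite (cod_letter cod c al).
elim: (om n a) => [|c w IH] /=; first by rewrite big_nil big1.
move=> /andP[cl /IH]; rewrite big_cons => ->.
under [RHS]eq_bigr do rewrite mulrnDr.
rewrite big_split /=; congr (_ + _).
rewrite (bigD1 (Ordinal cl)) //= eqxx mulr1n big1 ?addr0 // => i ic.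
have -> : (c == i :> nat) = false by apply: contraNF ic => /eqP e; apply/eqP/val_inj.
by rewrite mulr0n.
Qed.

Variables (G : zmodType) (P : set G) (u : G) (g : nat -> nat -> G).
Hypothesis P0 : P 0.
Hypothesis PD : forall a a', P a -> P a' -> P (a + a').
Hypothesis Pgen : forall v, exists a a', [/\ P a, P a' & v = a - a'].
Hypothesis model : tower_model P u l occ g.
Let gP := tm_pos model.
Let gM := tm_step model.
Let gu := tm_unit model.
Let gsurj := tm_surj model.
Let gker := tm_ker model.

(** The image in G of f, computed at stage n; it stabilizes as soon as f is
    constant on the levels of the towers. *)
Definition tower_value n f : G := \sum_(a < l n) g n a *~ tower_sum n f a.

Lemma tower_sum_occ n f a : level_constant n f -> (a < l n.+1)%N ->
  tower_sum n.+1 f a = \sum_(c < l n) tower_sum n f c *+ occ n a c.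
Proof. by move=> lev al; rewrite tower_sumS // sum_letters. Qed.

Lemma tower_valueS n f : level_constant n f -> tower_value n.+1 f = tower_value n f.
Proof.
move=> lev; rewrite /tower_value.
under eq_bigr => a _ do rewrite (tower_sum_occ lev) // mulrz_sumr.
rewrite exchange_big; apply: eq_bigr => c _ /=.
rewrite [in RHS]gM // mulrz_suml; apply: eq_bigr => a _.
by rewrite -mulr_natr natz mulrC mulrzA.
Qed.

Lemma tower_value_leq n m f : (n <= m)%N -> level_constant n f -> tower_value m f = tower_value n f.
Proof.
move=> /subnK <- lev; elim: (m - n)%N => // i <-.
by apply: tower_valueS; apply: level_constant_leq lev; apply: leq_addl.
Qed.

Definition K0_value f : G := tower_value (sval (cid (level_constant_exists f))) f.

Lemma K0_valueE n f : level_constant n f -> K0_value f = tower_value n f.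
Proof.
move=> lev; rewrite /K0_value; case: cid => m /= lev'.
by rewrite -(tower_value_leq (leq_maxl m n) lev') (tower_value_leq (leq_maxr m n) lev).
Qed.

Lemma K0_valueB : {morph K0_value : f f' / f - f'}.
Proof.
move=> f f'; have [n lf] := level_constant_exists f.
have [n' lf'] := level_constant_exists f'.
pose m := maxn n n'; have lm := level_constant_leq (leq_maxl n n') lf.
have lm' := level_constant_leq (leq_maxr n n') lf'.
have lB : level_constant m (f - f').
  move=> y y' a j al jh B B'.
  have E y1 : CZ_val (f - f') y1 = CZ_val f y1 - CZ_val f' y1 by [].
  by rewrite !E (lm y y' a j) // (lm' y y' a j).
rewrite (K0_valueE lB) (K0_valueE lm) (K0_valueE lm') /tower_value -sumrB; apply: eq_bigr => a _.
by rewrite -mulrzBr; congr (_ *~ _); rewrite /tower_sum -sumrB.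
Qed.

(** The sum of F o T - F over a tower telescopes to the difference of the
    values of F at two boundaries, which is 0 at high stages. *)
Lemma K0_value_coboundary f : f \in coboundary T -> K0_value f = 0.
Proof.
move=> /asboolP[F FE]; have [n lf] := level_constant_exists f.
have [n' Fc] := cut_constant F; pose m := maxn n n'.
rewrite (K0_valueE (level_constant_leq (leq_maxl n n') lf)) /tower_value big1 // => a _.
rewrite /tower_sum; set k := base_index _ _.
have E j : CZ_val f (orbit_pt (k * (h m)%:Z + j%:Z)) =
    CZ_val F (orbit_pt (k * (h m)%:Z + j.+1%:Z)) - CZ_val F (orbit_pt (k * (h m)%:Z + j%:Z)).
  by rewrite FE map_orbit_pt; congr (CZ_val F (orbit_pt _) - _); lia.
under eq_bigr do rewrite E.
rewrite telescope_sumr // addr0.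
have -> : k * h m + h m = (k + 1) * h m by lia.
by rewrite (Fc m k (k + 1)) ?leq_maxr // subrr mulr0z.
Qed.

(** Once all tower sums vanish, the partial sums of f from the base of
    the tower define a primitive: it returns to 0 exactly at the top. *)
Lemma K0_value_eq0 f : K0_value f = 0 -> f \in coboundary T.
Proof.
have [n lf] := level_constant_exists f; rewrite (K0_valueE lf) => f0.
have [|k nk s0] := gker (s := fun k => tower_sum k f) _ f0.
  by move=> k a nk al; apply: tower_sum_occ => //; exact: level_constant_leq lf.
have lk := level_constant_leq nk lf.
pose phi (aj : nat * nat) : int :=
  \sum_(0 <= i < aj.2) CZ_val f (orbit_pt (base_index k aj.1 * (h k)%:Z + i%:Z)).
apply/asboolP; exists (tower_fun k phi) => y.
rewrite !tower_funE.
have [al jh B] := tower_posP k y.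
set a := (tower_pos k y).1 in al B *; set j := (tower_pos k y).2 in jh B *.
have posE : tower_pos k y = (a, j) by rewrite -surjective_pairing.
have fy : CZ_val f y = CZ_val f (orbit_pt (base_index k a * (h k)%:Z + j%:Z)).
  by apply: (lk _ _ a j) => //; rewrite -{2}(base_indexP al); exact: orbit_pt_block.
have [jh1|jh1] := ltnP j.+1 (h k).
  have -> : tower_pos k (T y) = (a, j.+1).
    apply: tower_pos_eq => //; rewrite read_point_map; apply/block_at_shift.
    by have -> : - j.+1%:Z + 1 = - j%:Z by lia.
  by rewrite posE /phi /= big_nat_recr //= -fy addrAC subrr add0r.
have jE : j.+1 = h k by lia.
have [a' al' B'] := tower_next cod K_gt0 (read_point_hull y) B.
have -> : tower_pos k (T y) = (a', 0%N).
  apply: tower_pos_eq => //; first exact: (height_gt0 cod K_gt0).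
  rewrite read_point_map; apply/block_at_shift.
  by have <- : - j%:Z + h k = - 0%:Z + 1 by lia.
rewrite posE /phi /= big_geq // sub0r; apply/eqP.
have := s0 a al; rewrite /tower_sum -jE big_nat_recr //= jE -fy.
by move/eqP; rewrite addrC addr_eq0.
Qed.

(** A nonnegative combination of the classes [g n a] comes from the function
    with the given coefficients on the bases of the towers and 0 elsewhere. *)
Lemma K0_value_surj_pos v : P v -> exists2 f, (forall y, 0 <= CZ_val f y) & K0_value f = v.
Proof.
move=> /gsurj[n [x ->]].
pose phi (aj : nat * nat) : int := if aj.2 == 0%N then (x aj.1)%:Z else 0.
exists (tower_fun n phi) => [y|]; first by rewrite tower_funE /phi; case: ifP.
rewrite (K0_valueE (tower_fun_level_constant (n := n) phi)) /tower_value; apply: eq_bigr => a _.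
rewrite pmulrn; congr (_ *~ _); rewrite /tower_sum.
have E j : (j < h n)%N -> CZ_val (tower_fun n phi)
    (orbit_pt (base_index n a * (h n)%:Z + j%:Z)) = if j == 0%N then (x a)%:Z else 0.
  by move=> jh; rewrite tower_funE tower_pos_pt // base_indexP.
have h0 := height_gt0 cod K_gt0 n.
rewrite big_ltn // E // big_nat big1 ?addr0 // => j /andP[j0 jh].
by rewrite E // gtn_eqF.
Qed.

Lemma K0_value_pos f : (forall y, 0 <= CZ_val f y) -> P (K0_value f).
Proof.
move=> f0; have [n lf] := level_constant_exists f; rewrite (K0_valueE lf).
by apply: (cone_sum P0 PD) => a al; [exact: gP|exact: sumr_ge0].
Qed.

Lemma K0_value_one : K0_value (CZ_one _) = u.
Proof.
have lev : level_constant 0 (CZ_one (subshift_space Y)) by [].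
rewrite (K0_valueE lev) gu; apply: eq_bigr => a _.
by rewrite /tower_sum big_nat1 mulr1z.
Qed.

Definition K0_map (v : K0 T) : G := K0_value (repr v).

Lemma K0_mapE f : K0_map (\pi_(K0 T) f) = K0_value f.
Proof.
apply/eqP; rewrite -subr_eq0 -K0_valueB; apply/eqP/K0_value_coboundary.
by rewrite Quotient.idealrBE reprK.
Qed.

Lemma K0_map_zmod_morphism : zmod_morphism K0_map.
Proof.
move=> v w; rewrite -[v]reprK -[w]reprK -raddfB !K0_mapE; exact: K0_valueB.
Qed.
HB.instance Definition _ :=
  GRing.isZmodMorphism.Build (K0 T) G K0_map K0_map_zmod_morphism.

Lemma K0_iso : unital_ordered_group_iso (K0_cone T) (K0_unit T) P u.
Proof.
exists (K0_map : {additive K0 T -> G}); split; last exact: etrans (K0_mapE _) K0_value_one.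
  rewrite -setTT_bijective; split=> //.
    move=> v w _ _ e0; have e : K0_map v = K0_map w := e0; apply/eqP; rewrite -subr_eq0.
    have : K0_map (v - w) = 0 by rewrite K0_map_zmod_morphism e subrr.
    rewrite -[v - w]reprK K0_mapE => /K0_value_eq0 H.
    by rewrite -(raddf0 (\pi_(K0 T))) -Quotient.idealrBE subr0.
  move=> v _; have [a [a' [/K0_value_surj_pos[f _ <-] /K0_value_surj_pos[f' _ <-] ->]]] := Pgen v.
  by exists (\pi_(K0 T) (f - f')) => //; exact: etrans (K0_mapE _) (K0_valueB _ _).
apply/seteqP; split=> [_ [_ [f [-> f0]] <-]|v /K0_value_surj_pos[f f0 <-]].
  by have := K0_value_pos f0; rewrite -K0_mapE.
by exists (\pi_(K0 T) f); [exists f|exact: K0_mapE].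
Qed.

End DynamicalDimensionGroup.

(** * Numerical presentations of simple dimension groups *)
Section LimitClasses.
Variables (d : nat -> nat) (A : forall i, 'M[int]_(d i.+1, d i)).
Local Notation cls := (ilim_class (mx_hom A)).

Lemma ilim_class_zmod_morphism i :
  zmod_morphism (cls (i := i) : 'cV[int]_(d i) -> mx_ilim A).
Proof.
move=> v w; rewrite -[RHS]/(ilim_add (cls v) (ilim_opp (cls w))).
by rewrite ilim_oppE ilim_addE.
Qed.

Fixpoint push_vec m n (v : 'cV[int]_(d n)) : 'cV[int]_(d (m + n)) :=
  if m is m'.+1 then (A (m' + n) *m push_vec m' v)%R else v.

Lemma iter_ilim_step m n (v : 'cV[int]_(d n)) :
  iter m (ilim_step (mx_hom A)) (Tagged _ v) = Tagged _ (push_vec m v).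
Proof. by elim: m => //= m ->. Qed.

Lemma push_vec0 m n : push_vec m (0 : 'cV[int]_(d n)) = 0.
Proof. by elim: m => //= m ->; rewrite mulmx0. Qed.

Lemma ilim_class_eq0 n (v : 'cV[int]_(d n)) :
  cls v = 0 :> mx_ilim A -> exists m, push_vec m v = 0.
Proof.
rewrite -[0 in X in X -> _]/(ilim_zero (mx_hom A)) (ilim_zeroE _ n) => /eqP.
move=> /ilim_class_eqP[m [m' e]]; exists m.
have em : m = m'.
  by have := congr1 (@tag _ _) e; rewrite !ilim_tag /=; apply: addIn.
case: m' / em e; rewrite !iter_ilim_step push_vec0 => e.
have := congr1 (fun w => tagged_as (Tagged (fun i => 'cV[int]_(d i)) (push_vec m v)) w) e.
by rewrite !tagged_asE.
Qed.

End LimitClasses.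

(** The images E n c of the basis vectors in the limit, with indices read modulo
    the dimension so that no bounds are needed.  The kernel condition says that
    a relation dies after finitely many steps; the scalars r k allow the
    vectors to be rescaled along the way. *)
Record presentation (G : zmodType) (P : set G) (d : nat -> nat)
  (A : nat -> nat -> nat -> nat) (E : nat -> nat -> G) : Prop := Presentation {
  pr_d : forall n, (0 < d n)%N;
  pr_A : forall n a c, (0 < A n a c)%N;
  pr_Amodl : forall n a c, A n (a %% d n.+1)%N c = A n a c;
  pr_Amodr : forall n a c, A n a (c %% d n)%N = A n a c;
  pr_Emod : forall n c, E n (c %% d n)%N = E n c;
  pr_P : forall n c, P (E n c);
  pr_E : forall n c, E n c = \sum_(a < d n.+1) E n.+1 a *+ A n a c;
  pr_surj : forall v, P v -> exists n (s : nat -> nat),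
    v = \sum_(c < d n) E n c *+ s c;
  pr_ker : forall n (s : nat -> nat -> int) (r : nat -> int),
    (forall k a, (n <= k)%N -> (a < d k.+1)%N ->
       s k.+1 a = r k * \sum_(c < d k) s k c *+ A k a c) ->
    \sum_(c < d n) E n c *~ s n c = 0 ->
    exists2 k, (n <= k)%N & forall a, (a < d k)%N -> s k a = 0
}.

Lemma dimension_group_presentation (G : zmodType) (P : set G) (d : nat -> nat)
    (A : forall i, 'M[int]_(d i.+1, d i)) :
  (forall i, (1 <= d i)%N) -> (forall i j k, 0 < A i j k) ->
  ordered_group_iso P (mx_ilim_cone A) ->
  exists A' E, presentation P d A' E.
Proof.
move=> d0 A0 [phi [phib phiP]].
pose mI n c : 'I_(d n) := Ordinal (ltn_pmod c (d0 n)).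
have mIK n (c : 'I_(d n)) : mI n c = c by apply: val_inj; rewrite /= modn_small.
have mImod n c : mI n (c %% d n)%N = mI n c by apply: val_inj; rewrite /= modn_mod.
pose cls n : 'cV[int]_(d n) -> mx_ilim A := ilim_class (mx_hom A) (i := n).
pose clsM n := GRing.isZmodMorphism.Build _ _ (cls n) (@ilim_class_zmod_morphism _ A n).
pose clsA n : {additive 'cV[int]_(d n) -> mx_ilim A} :=
  HB.pack (cls n) (clsM n).
have [psi phiK psiK] := phib.
pose E n c := psi (clsA n (delta_mx (mI n c) 0)).
pose A' n a c := absz (A n (mI n.+1 a) (mI n c)).
have A'E n a c : (A' n a c)%:Z = A n (mI n.+1 a) (mI n c).
  by rewrite /A' gtz0_abs.
have phiE n (s : nat -> int) :
    phi (\sum_(c < d n) E n c *~ s c) = cls n (\col_(c < d n) s c).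
  rewrite raddf_sum -[cls n]/(clsA n : _ -> _).
  have -> : (\col_(c < d n) s c) = \sum_(c < d n) delta_mx c 0 *~ s c.
    apply/colP => i; rewrite mxE summxE (bigD1 i) //= big1 ?addr0.
      by rewrite -scaler_int !mxE !eqxx mulr1 intz.
    by move=> j ji; rewrite -scaler_int !mxE eq_sym (negPf ji) mulr0.
  rewrite raddf_sum; apply: eq_bigr => c _.
  by rewrite !raddfMz /E psiK mIK.
exists A', E; split.
- exact: d0.
- by move=> n a c; rewrite -ltz_nat A'E.
- by move=> n a c; rewrite /A' mImod.
- by move=> n a c; rewrite /A' mImod.
- by move=> n c; rewrite /E mImod.
- move=> n c; rewrite /E; have : mx_ilim_cone A (clsA n (delta_mx (mI n c) 0)).
    by exists n, (delta_mx (mI n c) 0); split=> // j; rewrite mxE; case: andP.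
  by rewrite -phiP => -[g Pg <-]; rewrite phiK.
- move=> n c; apply: (can_inj phiK).
  rewrite /E psiK (phiE n.+1 (fun a => (A' n a c)%:Z)).
  rewrite -[LHS](ilim_class_step (mx_hom A)) -[RHS]/(ilim_class _ _); congr ilim_class.
  rewrite /mx_hom /= -colE; apply/colP => i; rewrite !mxE A'E mIK //.
- move=> v Pv; have : (phi @` P) (phi v) by exists v.
  rewrite phiP => -[n [y [yE y0]]]; exists n, (fun c => absz (y (mI n c) 0)).
  apply: (can_inj phiK); rewrite (phiE n (fun c => (absz (y (mI n c) 0))%:Z)) yE.
  by congr ilim_class; apply/colP => i; rewrite mxE mIK gez0_abs.
move=> n s r sr /(congr1 phi); rewrite phiE raddf0 => /ilim_class_eq0[m pm].
exists (m + n)%N; first exact: leq_addl.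
(* s stays a multiple of the actual image of its initial value. *)
suff [C HC] : exists C, forall c : 'I_(d (m + n)),
    s (m + n)%N c = C * push_vec A m (\col_(c < d n) s n c) c 0.
  by move=> a al; have /= -> := HC (Ordinal al); rewrite pm mxE mulr0.
elim: m {pm} => [|m [C HC]]; first by exists 1 => c; rewrite mxE mul1r.
exists (r (m + n)%N * C) => c /=; rewrite sr ?leq_addl // -mulrA; congr (_ * _).
rewrite mxE mulr_sumr; apply: eq_bigr => j _.
by rewrite HC -mulr_natr natz A'E !mIK; ring.
Qed.

(** * Unperforation and the weights of the unit *)
Section PresentedGroup.
Variables (G : zmodType) (P : set G) (d : nat -> nat)
  (A : nat -> nat -> nat -> nat) (E : nat -> nat -> G).
Hypothesis og : is_ordered_group P.
Hypothesis pr : presentation P d A E.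

Lemma cone0 : P 0.
Proof. by have [] : (P `&` [set a | P (- a)]) 0 by rewrite (og_proper og). Qed.

Lemma cone_anti v : P v -> P (- v) -> v = 0.
Proof.
by move=> Pv PNv; have : (P `&` [set a | P (- a)]) v by []; rewrite (og_proper og).
Qed.

Definition lift_vec k (s : nat -> int) : nat -> int :=
  fun a => \sum_(c < d k) s c *+ A k a c.

Fixpoint lift_vec_to n (s : nat -> int) k : nat -> int :=
  if k is k'.+1 then if (k <= n)%N then s else lift_vec k' (lift_vec_to n s k') else s.

Lemma lift_vec_to_id n s : lift_vec_to n s n = s.
Proof. by case: n => //= n; rewrite leqnn. Qed.

Lemma lift_vec_toS n s k : (n <= k)%N -> lift_vec_to n s k.+1 = lift_vec k (lift_vec_to n s k).
Proof. by move=> nk /=; rewrite ltnNge nk. Qed.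

Lemma lift_vec_to_ge0 n (s : nat -> int) k : (forall c, 0 <= s c) ->
  forall c, 0 <= lift_vec_to n s k c.
Proof.
move=> s0; elim: k => //= k IH c; case: ifP => // _.
by apply: sumr_ge0 => i _; rewrite mulrn_wge0.
Qed.

Lemma lift_vec_sum k (s : nat -> int) :
  \sum_(c < d k) E k c *~ s c = \sum_(a < d k.+1) E k.+1 a *~ lift_vec k s a.
Proof.
rewrite /lift_vec; under [RHS]eq_bigr do rewrite mulrz_sumr.
rewrite exchange_big; apply: eq_bigr => c _ /=.
rewrite [in LHS](pr_E pr) mulrz_suml; apply: eq_bigr => a _.
by rewrite -mulr_natr natz mulrC mulrzA.
Qed.

Lemma lift_vec_to_sum n (s : nat -> int) k : (n <= k)%N ->
  \sum_(c < d n) E n c *~ s c = \sum_(c < d k) E k c *~ lift_vec_to n s k c.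
Proof.
move=> /subnK <-; elim: (k - n)%N => [|i ->]; first by rewrite lift_vec_to_id.
by rewrite addSn lift_vec_toS ?leq_addl // lift_vec_sum.
Qed.

Lemma cone_rep v : P v -> exists n, forall k, (n <= k)%N ->
  exists2 s : nat -> nat, True & v = \sum_(c < d k) E k c *+ s c.
Proof.
move=> /(pr_surj pr)[n [s ->]]; exists n => k nk.
pose t := lift_vec_to n (fun c => (s c)%:Z) k.
exists (fun c => absz (t c)) => //.
rewrite (@lift_vec_to_sum n (fun c => (s c)%:Z) _ nk); apply: eq_bigr => c _.
by rewrite pmulrn gez0_abs // lift_vec_to_ge0.
Qed.

Lemma group_rep v : exists n, forall k, (n <= k)%N ->
  exists s : nat -> int, v = \sum_(c < d k) E k c *~ s c.
Proof.
have [a [a' [/cone_rep[n Hn] /cone_rep[n' Hn'] ->]]] := og_generating og v.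
exists (maxn n n') => k; rewrite geq_max => /andP[/Hn[s _ ->] /Hn'[s' _ ->]].
exists (fun c => (s c)%:Z - (s' c)%:Z); rewrite -sumrB; apply: eq_bigr => c _.
by rewrite mulrzBr.
Qed.

(** At a common stage k v and a nonnegative vector t have representatives whose
    difference dies later on; there k v, hence v, is nonnegative. *)
Lemma unperforated v k : (0 < k)%N -> P (v *+ k) -> P v.
Proof.
move=> k0 /cone_rep[n Hn]; have [n' Hn'] := group_rep v.
pose m := maxn n n'; have [t _ tE] := Hn m (leq_maxl _ _).
have [s vE] := Hn' m (leq_maxr _ _).
pose S j c := lift_vec_to m s j c *+ k - lift_vec_to m (fun c => (t c)%:Z) j c.
have [||j mj Sj] := @pr_ker _ _ _ _ _ pr m S (fun=> 1).
- move=> j a mj al; rewrite mul1r /S !lift_vec_toS // /lift_vec -sumrMnl -sumrB.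
  by apply: eq_bigr => c _; rewrite mulrnBl mulrnAC.
- rewrite /S !lift_vec_to_id.
  under eq_bigr do rewrite mulrzBr -mulr_natr natz mulrzA.
  by rewrite sumrB -mulrz_suml -vE -[in X in _ - X]tE subrr.
rewrite vE (lift_vec_to_sum _ mj); apply: (@cone_sum G P (E j) (lift_vec_to m s j)).
- exact: cone0.
- exact: og_add og.
- by move=> c _; apply: (pr_P pr).
move=> c cl; have /eqP := Sj c cl; rewrite subr_eq0 => /eqP e.
by rewrite -(pmulrn_lge0 _ k0) e; apply: lift_vec_to_ge0.
Qed.

(** A torsion element is positive together with its opposite. *)
Lemma torsion_free (v : G) k : (0 < k)%N -> v *+ k = 0 -> v = 0.
Proof.
move=> k0 v0; apply: cone_anti; apply: (@unperforated _ k) => //.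
  by rewrite v0; exact: cone0.
by rewrite mulNrn v0 oppr0; exact: cone0.
Qed.

Lemma cone_mulrn_inj k (v w : G) : (0 < k)%N -> v *+ k = w *+ k -> v = w.
Proof.
move=> k0 e; apply/eqP; rewrite -subr_eq0; apply/eqP/(torsion_free k0).
by rewrite mulrnBl e subrr.
Qed.

(** Positive vectors stay positive under positive matrices, so that the class of
    (1, ..., 1) does not vanish. *)
Lemma presentation_nontrivial : exists v, v != 0 :> G.
Proof.
exists (\sum_(c < d 0) E 0 c *~ 1); apply/eqP => e0.
pose s := lift_vec_to 0 (fun=> 1).
have [||k _ sk] := @pr_ker _ _ _ _ _ pr 0 s (fun=> 1).
- by move=> k a _ _; rewrite mul1r /s lift_vec_toS.
- exact: e0.
have pos j a : 0 < s j a.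
  elim: j a => // j IH a; rewrite /s lift_vec_toS // /lift_vec.
  rewrite (bigD1 (Ordinal (pr_d pr j))) //= ltr_wpDr //.
    by apply: sumr_ge0 => i _; rewrite mulrn_wge0 // ltW // IH.
  by rewrite pmulrn_lgt0 ?(pr_A pr) // IH.
by have := pos k 0%N; rewrite sk ?(pr_d pr).
Qed.

(** An order unit 0 would make every element both positive and negative; so the
    unit is not 0, and it has a nonzero nonnegative representative, which becomes
    strictly positive after one step. *)
Lemma unit_weights u : is_order_unit P u -> exists i (w : nat -> nat),
  [/\ forall c, (0 < w c)%N, forall c, w (c %% d i)%N = w c
    & u = \sum_(c < d i) E i c *+ w c].
Proof.
move=> [Pu Hu]; have [i Hi] := cone_rep Pu.
have [s _ uE] := Hi i (leqnn i).
exists i.+1, (fun a => \sum_(c < d i) A i a c * s c)%N; split=> [a|a|].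
- rewrite lt0n; apply/eqP => s0.
  suff u0 : u = 0.
    have [v /eqP[]] := presentation_nontrivial; apply: cone_anti.
      by have [k] := Hu (- v); rewrite u0 mul0rn sub0r opprK.
    by have [k] := Hu v; rewrite u0 mul0rn sub0r.
  rewrite uE big1 // => c _; have /eqP := s0.
  rewrite sum_nat_eq0 => /forallP/(_ c); rewrite muln_eq0 eqn0Ngt (pr_A pr) /=.
  by move=> /eqP->; rewrite mulr0n.
- by apply: eq_bigr => c _; rewrite (pr_Amodl pr).
rewrite uE; apply: etrans (lift_vec_sum i (fun c => (s c)%:Z)) _.
apply: eq_bigr => a _.
rewrite pmulrn /lift_vec; congr (_ *~ _).
rewrite (big_morph Posz PoszD (erefl _)); apply: eq_bigr => c _.
by rewrite -mulr_natr natz PoszM mulrC.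
Qed.

End PresentedGroup.

(** * Words with prescribed letter counts *)
Section RunWords.

Definition tail_word (m : nat -> nat) k :=
  flatten [seq nseq (m c) c | c <- iota 2 k].

Lemma tail_wordS m k : tail_word m k.+1 = tail_word m k ++ nseq (m k.+2) k.+2.
Proof.
by rewrite /tail_word -(addn1 k) iotaD map_cat flatten_cat /= cats0 !add2n ?addn1.
Qed.

Lemma count_tail_word m k c :
  count_mem c (tail_word m k) = if (1 < c < k.+2)%N then m c else 0%N.
Proof.
elim: k => [|k IH]; first by rewrite /=; case: ifP => //; lia.
rewrite tail_wordS count_cat IH count_nseq /=.
by case: (eqVneq k.+2 c) => [<-|kc]; do 2?[case: ifP]; lia.
Qed.

Lemma size_tail_word m k : size (tail_word m k) = (\sum_(2 <= c < k.+2) m c)%N.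
Proof.
elim: k => [|k IH]; first by rewrite big_geq.
by rewrite tail_wordS size_cat IH size_nseq [RHS]big_nat_recr.
Qed.

Lemma mem_tail_word m k c : c \in tail_word m k -> (1 < c)%N.
Proof. by case/flattenP => _ /mapP[i + ->] /nseqP[-> _]; rewrite mem_iota; lia. Qed.

(** The letter a is encoded by where the first 1 stands, independently of the
    counts m. *)
Definition run_word l (m : nat -> nat) a :=
  nseq a.+1 0%N ++ nseq (m 1%N) 1%N ++ nseq (m 0%N - a.+1) 0%N ++ tail_word m (l - 2).

Variables (l : nat) (m : nat -> nat) (a : nat).
Hypothesis l2 : (2 < l)%N.
Hypothesis m0 : forall c, (0 < m c)%N.
Hypothesis am : (a < m 0)%N.

Lemma l_split : (l - 2).+2 = l. Proof. by lia. Qed.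

Lemma count_run_word c :
  count_mem c (run_word l m a) = if (c < l)%N then m c else 0%N.
Proof.
rewrite /run_word !count_cat !count_nseq count_tail_word l_split /=.
by case: c => [|[|c]] /=; case: ifP; move: am; lia.
Qed.

Lemma mem_run_word c : (c \in run_word l m a) = (c < l)%N.
Proof.
by rewrite -has_pred1 has_count count_run_word; case: ifP => // _; rewrite m0.
Qed.

Lemma size_run_word : size (run_word l m a) = (\sum_(c < l) m c)%N.
Proof.
rewrite /run_word !size_cat !size_nseq size_tail_word l_split -(big_mkord xpredT m).
rewrite [RHS]big_ltn 1?[in RHS](@big_ltn _ _ _ 1); [|exact: ltnW|exact: ltnW (ltnW l2)].
by move: am; lia.
Qed.

Lemma run_word_last : last 0%N (run_word l m a) = l.-1.
Proof.
rewrite /run_word; have -> : (l - 2 = (l - 3).+1)%N by lia.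
rewrite tail_wordS !catA last_cat; have := m0 (l - 3).+2.
case: (m _) => // i _ /=; have -> : last (l - 3).+2 (nseq i (l - 3).+2) = (l - 3).+2.
  by elim: i.
by lia.
Qed.

(** Only letters below 2 occur in the first three runs, and no 0 occurs after
    them. *)
Lemma run_word_marker j : (j.+1 < size (run_word l m a))%N ->
  nth 0%N (run_word l m a) j = l.-1 -> nth 0%N (run_word l m a) j.+1 <> 0%N.
Proof.
pose w1 := nseq a.+1 0%N ++ nseq (m 1%N) 1%N ++ nseq (m 0%N - a.+1) 0%N.
have -> : run_word l m a = w1 ++ tail_word m (l - 2) by rewrite /run_word /w1 -!catA.
have w1lt i : (nth 0%N w1 i < 2)%N.
  have [iw|iw] := ltnP i (size w1); last by rewrite nth_default.
  have := mem_nth 0%N iw.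
  by rewrite !mem_cat => /orP[|/orP[]] /nseqP[-> _].
clearbody w1; rewrite size_cat => js; rewrite !nth_cat.
have [jw1|jw1] := ltnP j (size w1).
  by move=> e; have := w1lt j; move: l2; rewrite e; lia.
have -> : (j.+1 < size w1)%N = false by lia.
move=> _.
have /(mem_nth 0%N)/mem_tail_word : (j.+1 - size w1 < size (tail_word m (l - 2)))%N by lia.
by move=> H e; rewrite e in H.
Qed.

Lemma index_run_word : index 1%N (run_word l m a) = a.+1.
Proof.
rewrite /run_word index_cat mem_nseq andbF size_nseq.
by have := m0 1; case: (m 1%N) => // i _ /=; rewrite addn0.
Qed.

End RunWords.

Lemma sum_fold3 (V : zmodType) d (H : nat -> V) :
  \sum_(c < 3 * d) H c = \sum_(c < d) (H c + H (d + c)%N + H (2 * d + c)%N).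
Proof.
rewrite -(big_mkord xpredT H) big_nat_mul !big_nat_recr //= big_geq // add0r.
rewrite !big_split /= -(big_mkord xpredT H) -(big_mkord xpredT (fun c => H (d + c)%N)).
rewrite -(big_mkord xpredT (fun c => H (2 * d + c)%N)); congr (_ + _ + _).
- by rewrite mul0n mul1n.
- by rewrite -{1}[(1 * d)%N]add0n big_addn mulSn addnK mul1n; apply: eq_bigr => c _; rewrite addnC.
- by rewrite -{1}[(2 * d)%N]add0n big_addn mulSn addnK; apply: eq_bigr => c _; rewrite addnC.
Qed.

Lemma sum_periodic3 (V : zmodType) d (H : nat -> V) :
  (forall c, H (c %% d)%N = H c) -> \sum_(c < 3 * d) H c = (\sum_(c < d) H c) *+ 3.
Proof.
move=> Hd; rewrite sum_fold3 -sumrMnl; apply: eq_bigr => c _.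
rewrite -(Hd (d + c)%N) -(Hd (2 * d + c)%N) modnDl modnMDl Hd.
by rewrite !mulrS mulr0n addr0 addrA.
Qed.

(** * From the unit to substitutions of constant length *)
Lemma presentation_shift (G : zmodType) (P : set G) d A E i :
  presentation P d A E ->
  presentation P (fun n => d (n + i)%N) (fun n => A (n + i)%N) (fun n => E (n + i)%N).
Proof.
move=> pr; split.
- by move=> n; apply: (pr_d pr).
- by move=> n; apply: (pr_A pr).
- by move=> n; apply: (pr_Amodl pr).
- by move=> n; apply: (pr_Amodr pr).
- by move=> n; apply: (pr_Emod pr).
- by move=> n; apply: (pr_P pr).
- by move=> n; apply: (pr_E pr).
- move=> v /(cone_rep pr)[n Hn]; have [s _ ->] := Hn _ (leq_addr i n).
  by exists n, s.
move=> n s r sr s0.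
have := @pr_ker _ _ _ _ _ pr (n + i)%N (fun k => s (k - i)%N) (fun k => r (k - i)%N).
case=> [k a nk al||k nk sk].
- have ik : (i <= k)%N by lia.
  move: al; rewrite subSn // -(subnK ik) addnK => al.
  by rewrite sr ?subnK //; lia.
- by rewrite addnK.
exists (k - i)%N; first by lia.
by move=> a; rewrite subnK => [|]; [exact: sk|lia].
Qed.

Section Weights.
Variables (G : zmodType) (P : set G) (u : G) (d : nat -> nat)
  (A : nat -> nat -> nat -> nat) (E : nat -> nat -> G) (w : nat -> nat).
Hypothesis og : is_ordered_group P.
Hypothesis pr : presentation P d A E.
Hypothesis w_gt0 : forall c, (0 < w c)%N.
Hypothesis w_mod : forall c, w (c %% d 0)%N = w c.
Hypothesis uE : u = \sum_(c < d 0) E 0 c *+ w c.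

(** The coordinates of the unit at stage n. *)
Fixpoint weight n a : nat :=
  if n is n'.+1 then (\sum_(c < d n') A n' a c * weight n' c)%N else w a.

Lemma weight_gt0 n a : (0 < weight n a)%N.
Proof.
elim: n a => //= n IH a; rewrite (bigD1 (Ordinal (pr_d pr n))) //=.
by rewrite addn_gt0 muln_gt0 (pr_A pr) IH.
Qed.

Lemma weight_mod n a : weight n (a %% d n)%N = weight n a.
Proof. by case: n => //= n; apply: eq_bigr => c _; rewrite (pr_Amodl pr). Qed.

(** Three letters for each index, c and c' being copies of the same index when
    they are congruent modulo d n. *)
Definition letters n := (3 * d n)%N.
Local Notation l := letters.

(** A common multiple of the weights clears the denominators; the extra factor
    makes the counts larger than the number of letters of the next level, so
    that the first run can encode such a letter. *)
Definition row_scale n := ((l n.+1).+1 * \prod_(a < d n.+1) weight n.+1 a)%N.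

Definition row_count n a c := (row_scale n %/ weight n.+1 a * (A n a c * weight n c))%N.

Lemma dim_gt0 n : (0 < d n)%N. Proof. exact: pr_d pr n. Qed.

Lemma weight_dvd n a : (weight n.+1 a %| \prod_(a < d n.+1) weight n.+1 a)%N.
Proof.
rewrite -weight_mod (bigD1 (Ordinal (ltn_pmod a (dim_gt0 n.+1)))) //=.
exact: dvdn_mulr.
Qed.

Lemma row_scale_dvd n a : (weight n.+1 a %| row_scale n)%N.
Proof. exact/dvdn_mull/weight_dvd. Qed.

Lemma row_scale_gt0 n : (0 < row_scale n)%N.
Proof. by rewrite muln_gt0 ltn0Sn; apply: prodn_gt0 => a; apply: weight_gt0. Qed.

Lemma row_countE n a c :
  (weight n.+1 a * row_count n a c = row_scale n * (A n a c * weight n c))%N.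
Proof. by rewrite /row_count mulnA [(weight _ _ * _)%N]mulnC divnK // row_scale_dvd. Qed.

Lemma row_count_gt n a c : (l n.+1 < row_count n a c)%N.
Proof.
apply: (@leq_trans (row_scale n %/ weight n.+1 a)%N); last first.
  by apply: leq_pmulr; rewrite muln_gt0 (pr_A pr) weight_gt0.
rewrite leq_divRL ?weight_gt0 // leq_mul2l; apply/orP; right.
by apply: dvdn_leq (weight_dvd n a); apply: prodn_gt0 => i; apply: weight_gt0.
Qed.

Lemma row_count_gt0 n a c : (0 < row_count n a c)%N.
Proof. exact: leq_ltn_trans (row_count_gt n a c). Qed.

Lemma sum_nat_periodic3 d' (H : nat -> nat) : (forall c, H (c %% d')%N = H c) ->
  (\sum_(c < 3 * d') H c = 3 * \sum_(c < d') H c)%N.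
Proof.
move=> Hd; apply/eqP; rewrite -(eqr_nat int) natr_sum.
rewrite (sum_periodic3 (H := fun c => (H c)%:R : int)) => [|c]; last by rewrite Hd.
by rewrite natrM natr_sum mulr_natl.
Qed.

Lemma sum_row_count n a : (\sum_(c < l n) row_count n a c = 3 * row_scale n)%N.
Proof.
rewrite sum_nat_periodic3 => [|c]; last by rewrite /row_count (pr_Amodr pr) weight_mod.
congr (3 * _)%N; rewrite -big_distrr /= -[X in (_ * X)%N]/(weight n.+1 a).
by rewrite divnK // row_scale_dvd.
Qed.

Definition letter_word n a := run_word (l n) (row_count n a) a.

Lemma weights_coding : coding l (fun n => 3 * row_scale n)%N letter_word.
Proof.
have l2 n : (2 < l n)%N by have := dim_gt0 n; rewrite /l; lia.
have am n a : (a < l n.+1)%N -> (a < row_count n a 0)%N.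
  by move=> al; apply: ltn_trans al (row_count_gt n a 0).
split.
- by move=> n; apply: ltnW.
- by move=> n; have := row_scale_gt0 n; lia.
- by move=> n a al; rewrite (size_run_word (l2 n) (am n a al)) sum_row_count.
- by move=> n a c al; rewrite (mem_run_word (l2 n) (row_count_gt0 n a) (am n a al)).
- by [].
- move=> n a al; rewrite -(sum_row_count n a) -(size_run_word (l2 n) (am n a al)).
  by rewrite nth_last (run_word_last (l2 n) (row_count_gt0 n a) (am n a al)).
- move=> n a j al jb; apply: (run_word_marker (l2 n) (am n a al)).
  by rewrite (size_run_word (l2 n) (am n a al)) sum_row_count.
move=> n a a' al al' e; apply: succn_inj.
rewrite -(index_run_word (l n) a (row_count_gt0 n a)) -/(letter_word n a) e.
exact: index_run_word (row_count_gt0 n a').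
Qed.

Lemma count_letter_word n a c : (a < l n.+1)%N -> (c < l n)%N ->
  count_mem c (letter_word n a) = row_count n a c.
Proof.
move=> al cl; rewrite count_run_word ?cl //.
- by have := dim_gt0 n; rewrite /l; lia.
- exact: ltn_trans al (row_count_gt n a 0).
Qed.

Hypothesis div : divisible G.
Variable K : nat -> nat.
Hypothesis K_gt0 : forall n, (0 < K n)%N.
Local Notation h := (height (fun n => 3 * row_scale n)%N K).
Local Notation q := (sub_len (fun n => 3 * row_scale n)%N K).

Lemma triple_height_gt0 n : (0 < 3 * h n)%N.
Proof. by have := height_gt0 weights_coding K_gt0 n; lia. Qed.

(** The class of the base of the tower of c.  This is where divisibility of the
    group enters. *)
Definition height_weight n c : G :=
  sval (cid (div (E n c *+ weight n c) (triple_height_gt0 n))).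
Local Notation g := height_weight.

Lemma height_weightE n c : g n c *+ (3 * h n) = E n c *+ weight n c.
Proof. exact: svalP (cid (div _ (triple_height_gt0 n))). Qed.

Local Notation M := (occ K letter_word).

Lemma occE n a c : (a < l n.+1)%N -> (c < l n)%N -> M n a c = (K n * row_count n a c)%N.
Proof. by move=> al cl; rewrite /occ count_letter_word. Qed.

Lemma height_weight_pos n c : P (g n c).
Proof.
apply: (unperforated og pr (triple_height_gt0 n)); rewrite height_weightE.
elim: (weight n c) => [|m IH]; first by rewrite mulr0n; exact: cone0 og.
by rewrite mulrS; apply: og_add og _ _ _ _ => //; exact: pr_P pr n c.
Qed.

Lemma height_weight_step n c : (c < l n)%N ->
  g n c = \sum_(a < l n.+1) g n.+1 a *+ M n a c.
Proof.
move=> cl; apply: (cone_mulrn_inj og pr (triple_height_gt0 n.+1)).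
rewrite -sumrMnl.
transitivity (\sum_(a < l n.+1) E n.+1 a *+ A n a c *+ (K n * row_scale n * weight n c)).
  rewrite sumrMnl (sum_periodic3 (H := fun a => E n.+1 a *+ A n a c)) => [|a]; last first.
    by rewrite (pr_Emod pr) (pr_Amodl pr).
  have -> : (3 * h n.+1 = 3 * h n * (3 * (K n * row_scale n)))%N.
    by rewrite -[h n.+1]/(q n * h n)%N /q; lia.
  by rewrite [LHS]mulrnA height_weightE -(pr_E pr) -!mulrnA; congr (_ *+ _); lia.
apply: eq_bigr => a _; rewrite (occE (ltn_ord a) cl).
rewrite [RHS]mulrnAC height_weightE -!mulrnA; congr (_ *+ _).
by rewrite [RHS]mulnCA row_countE; lia.
Qed.

Lemma height_weight_unit : u = \sum_(c < l 0) g 0 c.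
Proof.
apply: (cone_mulrn_inj og pr (triple_height_gt0 0)); rewrite -sumrMnl.
under eq_bigr do rewrite height_weightE.
rewrite (sum_periodic3 (H := fun c => E 0 c *+ w c)) => [|c].
  by rewrite -uE.
by rewrite (pr_Emod pr) w_mod.
Qed.

(** The coefficient h s / weight is an integer from stage 1 on, because the
    weights of stage n+1 divide the multiplier of stage n, hence h (n+1). *)
Lemma height_weight_surj v : P v -> exists n (s : nat -> nat),
  v = \sum_(c < l n) g n c *+ s c.
Proof.
move=> /(cone_rep pr)[n Hn]; have [s _ ->] := Hn n.+1 (leqnSn n).
exists n.+1, (fun c => h n.+1 %/ weight n.+1 c * s (c %% d n.+1))%N.
apply: (cone_mulrn_inj og pr (triple_height_gt0 n.+1)); rewrite -[RHS]sumrMnl.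
have wh c : (weight n.+1 c %| h n.+1)%N.
  by rewrite /= /q dvdn_mulr // dvdn_mulr // dvdn_mull // row_scale_dvd.
transitivity (\sum_(c < l n.+1) E n.+1 c *+ (s (c %% d n.+1)%N * h n.+1)).
  rewrite (sum_periodic3 (H := fun c => E n.+1 c *+ (s (c %% d n.+1)%N * h n.+1))).
    rewrite [(3 * _)%N]mulnC mulrnA; congr (_ *+ _).
    rewrite -sumrMnl; apply: eq_bigr => c _.
    by rewrite modn_small ?ltn_ord // [RHS]mulrnA.
  by move=> c; rewrite (pr_Emod pr) modn_mod.
apply: eq_bigr => c _; rewrite [RHS]mulrnAC height_weightE -mulrnA.
by congr (_ *+ _); rewrite mulnA [(weight _ _ * _)%N]mulnC divnK // mulnC.
Qed.

(** Adding the entries of s over the three copies of each index and multiplying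
    by the weights turns s into a sequence t that follows the matrices A up to
    the scalars q k, and that represents the same element up to 3 h n.  So t dies;
    and s at the next stage is determined by t. *)
Lemma height_weight_ker n (s : nat -> nat -> int) :
  (forall k a, (n <= k)%N -> (a < l k.+1)%N ->
     s k.+1 a = \sum_(c < l k) s k c *+ M k a c) ->
  \sum_(c < l n) g n c *~ s n c = 0 ->
  exists2 k, (n <= k)%N & forall a, (a < l k)%N -> s k a = 0.
Proof.
move=> sM s0.
pose t k c := (s k c + s k (d k + c)%N + s k (2 * d k + c)%N) * (weight k c)%:Z.
have fold (V : zmodType) k (F : nat -> V) : (forall c, F (c %% d k)%N = F c) ->
    \sum_(c < l k) F c *~ ((weight k c)%:Z * s k c) = \sum_(c < d k) F c *~ t k c.
  move=> Fp; rewrite (sum_fold3 _ (fun c => F c *~ ((weight k c)%:Z * s k c))).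
  apply: eq_bigr => c _; rewrite -![weight k (_ + _)]weight_mod -![F (_ + c)%N]Fp.
  rewrite modnDl modnMDl weight_mod Fp -!mulrzDr /t.
  by congr (_ *~ _); ring.
have step k a : (n <= k)%N -> (a < l k.+1)%N ->
    (weight k.+1 a)%:Z * s k.+1 a =
    (K k * row_scale k)%N%:Z * \sum_(c < d k) t k c *+ A k a c.
  move=> nk al; rewrite (sM k a nk al) mulr_sumr.
  transitivity ((K k * row_scale k)%N%:Z *
      \sum_(c < l k) (A k a c)%:Z *~ ((weight k c)%:Z * s k c)).
    rewrite mulr_sumr; apply: eq_bigr => c _; rewrite (occE al (ltn_ord c)).
    rewrite -mulr_natr natz mulrzz (PoszM (K k) (row_count k a c)) (PoszM (K k) (row_scale k)).
    transitivity (s k c * (K k)%:Z * ((weight k.+1 a)%:Z * (row_count k a c)%:Z)).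
      by ring.
    by rewrite -[(weight k.+1 a)%:Z * _]PoszM row_countE (PoszM (row_scale k)) PoszM; ring.
  rewrite (fold _ k (fun c => (A k a c)%:Z)) => [|c]; last by rewrite (pr_Amodr pr).
  congr (_ * _); apply: eq_bigr => c _.
  by rewrite mulrzz -mulr_natr natz mulrC.
have [k a nk al||k nk tk] := @pr_ker _ _ _ _ _ pr n t (fun k => (q k)%:Z).
- rewrite /t !mulrDl.
  have wE i : (i * d k.+1 + a < l k.+1)%N ->
      s k.+1 (i * d k.+1 + a)%N * (weight k.+1 a)%:Z =
      (K k * row_scale k)%N%:Z * \sum_(c < d k) t k c *+ A k a c.
    move=> il; have := step k _ nk il; rewrite -weight_mod modnMDl weight_mod mulrC => ->.
    by congr (_ * _); apply: eq_bigr => c _; rewrite -(pr_Amodl pr) modnMDl (pr_Amodl pr).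
  have := wE 0%N; have := wE 1%N; have := wE 2%N; rewrite mul0n mul1n add0n.
  have lE : l k.+1 = (3 * d k.+1)%N by [].
  move=> -> //; last by lia.
  move=> -> //; last by lia.
  move=> -> //; last by lia.
  by rewrite /q; set S := \sum_(c < d k) _; lia.
- rewrite -(fold _ n (E n)) => [|c]; last exact: pr_Emod pr n c.
  under eq_bigr do rewrite mulrzA -pmulrn -height_weightE pmulrn mulrzAC.
  by rewrite -mulrz_suml s0 mul0rz.
exists k.+1; first by lia.
move=> a al; have := step k a nk al; rewrite big1 => [|c _]; last by rewrite tk // mul0rn.
rewrite mulr0 => /eqP; rewrite mulf_eq0 => /orP[|/eqP//].
by have := weight_gt0 k.+1 a; lia.
Qed.

Lemma height_weight_model : tower_model P u l M g.
Proof.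
split.
- by move=> n c _; exact: height_weight_pos.
- exact: height_weight_step.
- exact: height_weight_unit.
- exact: height_weight_surj.
- exact: height_weight_ker.
Qed.

End Weights.

Theorem theorem1p3 (R : realType) (G : zmodType) (P : set G) (u : G)
    (p : nat -> R)
    (hG : is_simple_dimension_group_with_unit P u)
    (hp : forall n : nat, 0 < p n)
    (hlim : (n%:R / p n) @[n --> \oo] --> (0 : R))
    (hdiv : divisible G) :
  exists (A : finType) (Y : subshift A),
    [/\ (0 < #|A|)%N,
        is_toeplitz_subshift Y,
        minimal_system (@subshift_map A Y),
        unital_ordered_group_iso
          (K0_cone (@subshift_map A Y)) (K0_unit (@subshift_map A Y)) P u
      & ((complexity Y n)%:R / p n) @[n --> \oo] --> (0 : R)].
Proof.
have [[[og _] [d0 [A0 [d0_ge1 A0_gt0 iso]]]] unit] := hG.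
have [A1 [E1 pr1]] := dimension_group_presentation d0_ge1 A0_gt0 iso.
have [i [w [w_gt0 w_mod uE]]] := unit_weights og pr1 unit.
have pr := presentation_shift i pr1.
have cod := weights_coding pr w_gt0 w_mod.
set l := letters _ in cod; set b := (fun n => _) in cod; set om := letter_word _ _ _ in cod.
have [t Ht] := superlinear_thresholds hp hlim (complexity_factor l b).
pose K n := (t n.+1).+1; have K_gt0 n : (0 < K n)%N by [].
have model := height_weight_model og pr w_gt0 w_mod uE hdiv K_gt0.
pose Y := toeplitz_subshift cod K_gt0.
exists 'I_(l 0), Y; split.
- by rewrite card_ord; exact: ltnW (cod_l cod 0).
- exact: toeplitz_subshift_toeplitz.
- exact: toeplitz_subshift_minimal.
- exact: K0_iso (cone0 og) (og_add og) (og_generating og) model.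
have h_le n : (height b K n <= height b K n.+1)%N.
  by rewrite /= leq_pmull // (sub_len_gt0 cod K_gt0).
apply: (ratio_cvg0 hp Ht _ (height_gtn cod K_gt0) h_le (@complexity_linear _ _ _ _ cod K_gt0)).
move=> n; have := height_gt0 cod K_gt0 n; have := cod_b cod n => b1 h0.
by rewrite /= /sub_len /K; apply: leq_trans (leq_pmulr _ h0); nia.
Qed.
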